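(* Let $p\geq 2$ be a real number and let $F_p$ be the gamma distribution function with shape parameter $p$ and scale parameter $1$, i.e. with density $f_p(x)=\dfrac{e^{-x}x^{p-1}}{\Gamma(p)}$, $x>0$. Then for every $t>0$, $$\bigl\|M^{[2]}_{t}F_{p}-F_{p}\bigr\|\leq\Bigl(\frac{17}{12}+\frac{27}{16e}\Bigr)\frac{1}{t^{2}}\approx\frac{2.0375}{t^2}.$$
   Context: For a real-valued function $f$ on $[0,\infty)$, $\|f\|:=\sup_{x\geq 0}|f(x)|$. $[x]$ denotes the largest integer less than or equal to $x$. Let $(S(u),u\ge 0)$ be a gamma process: $S(0)=0$ and, for $u>0$, $S(u)$ has density $x^{u-1}e^{-x}/\Gamma(u)$, $x>0$. For $t>0$ and a function $g$ on $[0,\infty)$ for which the expectations are well defined, set, for $x\ge 0$, $$L_t g(x):=E\,g\Bigl(\frac{S(tx)}{t}\Bigr),\qquad L^{[2]}_t g(x):=2L_{2t}g(x)-L_t g(x),$$ $$M^{[2]}_t g(x):=(tx-[tx])\,L^{[2]}_t g\Bigl(\frac{[tx]+1}{t}\Bigr)+([tx]+1-tx)\,L^{[2]}_t g\Bigl(\frac{[tx]}{t}\Bigr).$$ The symbol $\approx$ only records the numerical value of the constant. *)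

(* Defs.v *)
From HB Require Import structures.
From mathcomp Require Import all_boot all_order all_algebra.
From mathcomp Require Import all_classical all_reals all_analysis.

Set Implicit Arguments.
Unset Strict Implicit.
Unset Printing Implicit Defensive.

Import Order.TTheory GRing.Theory Num.Theory.
Import numFieldNormedType.Exports.

Local Open Scope classical_set_scope.
Local Open Scope ring_scope.

Definition Gamma_fun (R : realType) (u : R) : R :=
  \int[@lebesgue_measure R]_(x in `]0, +oo[) (x `^ (u - 1) * expR (- x)).

(* The guard is needed: powR is not 0 at negative arguments. *)
Definition gamma_pdf (R : realType) (u x : R) : R :=
  if 0 < x then x `^ (u - 1) * expR (- x) / Gamma_fun u else 0.

Definition gamma_cdf (R : realType) (p : R) (x : R) : R :=
  \int[@lebesgue_measure R]_(y in `]-oo, x]) gamma_pdf p y.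

(* Only the one-dimensional laws are prescribed, since the operators below
   depend on nothing else; a process with independent stationary increments
   is a special case.  Only indices u >= 0 are constrained. *)
Definition gamma_process (R : realType) (d : measure_display)
    (T : measurableType d) (P : probability T R) (S : R -> {RV P >-> R}) : Prop :=
  {ae P, forall w, S 0 w = 0} /\
  forall u : R, 0 < u -> forall A : set R, measurable A ->
    distribution P (S u) A =
    (\int[@lebesgue_measure R]_(x in A) (gamma_pdf u x)%:E)%E.

Section operators.
Context {R : realType} {d : measure_display} {T : measurableType d}.
Variables (P : probability T R) (S : R -> {RV P >-> R}).

(* [fine] loses nothing when the expectation is finite, as it is for a bounded
   measurable g. *)
Definition gammaL (t : R) (g : R -> R) (x : R) : R :=
  fine ('E_P[fun w => (g (S (t * x) w / t))%R])%E.

Definition gammaL2 (t : R) (g : R -> R) (x : R) : R :=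
  2 * gammaL (2 * t) g x - gammaL t g x.

Definition gammaM2 (t : R) (g : R -> R) (x : R) : R :=
  let k : R := (Num.floor (t * x))%:~R in
  (t * x - k) * gammaL2 t g ((k + 1) / t) +
  (k + 1 - t * x) * gammaL2 t g (k / t).

End operators.

(* Supremum norm over [0, +oo[, in \bar R because [sup] of an unbounded set of
   reals is 0. *)
Definition sup_norm (R : realType) (f : R -> R) : \bar R :=
  ereal_sup [set `|f x|%:E | x in `[0, +oo[].

(* Main.v *)
Require Import Defs.
From HB Require Import structures.
From mathcomp Require Import all_boot all_order all_algebra.
From mathcomp Require Import all_classical all_reals all_analysis.
From mathcomp Require Import measurable_realfun ring lra.

(** Write F for the gamma distribution function of shape p, m = p - 1 >= 1 and
z = x - m.  On every cell [k/t, (k+1)/t] the operator M is the linear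
interpolation of the node values L2 F(k/t) and L2 F((k+1)/t).  Its error is
therefore at most the largest node error plus the error of linearly
interpolating F, which is at most sup |F''| / (8 t^2).

At a node k/t the variables S(k)/t and S(2k)/(2t) both have mean k/t, with
variances k/t^2 and k/(2 t^2), so the second order terms of the Taylor
expansions of E F(S(2k)/(2t)) and E F(S(k)/t) cancel in 2 L_{2t} - L_t.  What
remains is the third order term - (k/t) F'''(k/t) / (6 t^2) and a fourth order
remainder.  Since F'''' may be singular at 0, that remainder is bounded through
sup |x^2 F''''|: the Taylor remainder of F at K is at most
sup |x^2 F''''| (y - K)^4 / (12 K^2) for every y > 0 ([taylor4_ge]), and the
fourth central moment 3 u^2 + 6 u of the gamma law of shape u does the rest
([expectation_gamma_cdf_order4]).  The node error then is at most
(1.5938 + 7/24) / t^2 when k >= 4.  For k <= 3 the second order expansion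
already gives (5 k / 8) / t^2, because - 1/4 <= F'' <= 1
([expectation_gamma_cdf_order2]); for k = 0 the node error vanishes.

The bounds - 1/4 <= F'' <= 1, |x F'''| <= 7/4 and |x^2 F''''| <= 3, uniform in
p >= 2, come from elementary lower bounds for the Gamma function: F'', x F''' and
x^2 F'''' are the gamma density of shape m times a polynomial in z and 1/m.
The kernel y^a e^(-y) is monotone on either side of its mode a, so its value at
x, times an integral between the mode and x, is at most the corresponding
integral over the half-line: the total mass gives
[gamma_ker_peak_le_Gamma], and the second moment about the mean gives
[gamma_ker_cubic_le_Gamma].  These control the density times 1 + |x - a|
and the density times |z|^3 / m.

Altogether the error is at most (1.89 + 1/8) / t^2, and 2.015 is less than
17/12 + 27/(16 e). *)

Set Implicit Arguments.
Unset Strict Implicit.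
Unset Printing Implicit Defensive.

Import Order.TTheory GRing.Theory Num.Theory.
Import numFieldNormedType.Exports.

Local Open Scope classical_set_scope.
Local Open Scope ring_scope.

(** * Differentiable real functions *)

Lemma is_derive_invr (R : realType) (x : R) : 0 < x ->
  is_derive x 1 (fun y => y^-1) (- x^-1 ^+ 2).
Proof.
move=> x0; have x0' : x != 0 by rewrite gt_eqF.
apply: is_derive_eq; first exact: is_deriveV.
by rewrite /GRing.scale/= mulr1 exprVn.
Qed.

Lemma is_derive_continuous (R : realType) (f : R -> R) (x d : R) :
  is_derive x 1 f d -> {for x, continuous f}.
Proof. by case=> df _; exact/differentiable_continuous/derivable1_diffP. Qed.

Lemma eq_ler (R : realType) (x y : R) : x = y -> x <= y.
Proof. by move=> ->. Qed.

(** * The kernel x^a e^(-x) and its integral *)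

Definition gamma_ker (R : realType) (a x : R) : R := x `^ a * expR (- x).

Lemma gamma_kerE (R : realType) (a x : R) : 0 < x -> gamma_ker a x = expR (a * ln x - x).
Proof. by move=> x0; rewrite /gamma_ker /powR gt_eqF// expRD. Qed.

Lemma gamma_ker_ge0 (R : realType) (a x : R) : 0 <= gamma_ker a x.
Proof. by rewrite mulr_ge0 ?powR_ge0 ?expR_ge0. Qed.

Lemma gamma_ker_gt0 (R : realType) (a x : R) : 0 < x -> 0 < gamma_ker a x.
Proof. by move=> x0; rewrite mulr_gt0 ?powR_gt0 ?expR_gt0. Qed.

Lemma gamma_kerS (R : realType) (a x : R) : 0 < x -> gamma_ker (a + 1) x = x * gamma_ker a x.
Proof.
move=> x0; rewrite /gamma_ker powRD ?(gt_eqF x0) ?implybT// powRr1 ?ltW//.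
by rewrite mulrCA mulrA.
Qed.

Lemma measurable_gamma_ker (R : realType) (a : R) : measurable_fun setT (gamma_ker a).
Proof.
apply: measurable_funM; first exact: measurable_powR.
by apply: measurableT_comp => //; exact: measurable_expR.
Qed.

(** Concavity of the logarithm, ln x <= x / A - 1 + ln A, taken with
    A = 2 (a + 1) so that the linear term a x / A stays below x / 2. *)
Lemma gamma_ker_le_exp (R : realType) (a : R) : 0 <= a ->
  exists2 C : R, 0 < C & forall x, 0 < x -> gamma_ker a x <= C * expR (- (x / 2)).
Proof.
move=> a0; exists (expR (a * (ln (2 * (a + 1))))); first exact: expR_gt0.
move=> x x0; rewrite gamma_kerE// -expRD ler_expR.
have A0 : 0 < 2 * (a + 1) by lra.
have ineq : ln x <= x / (2 * (a + 1)) - 1 + ln (2 * (a + 1)).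
  rewrite -lerBlDr -ln_div ?posrE//.
  have := @le_ln1Dx R (x / (2 * (a + 1)) - 1).
  rewrite addrCA subrr addr0; apply; rewrite ltrBrDl subrr.
  by rewrite divr_gt0.
apply: (@le_trans _ _ (a * (x / (2 * (a + 1)) - 1 + ln (2 * (a + 1))) - x)).
  by rewrite lerD2r ler_wpM2l.
suff : a * (x / (2 * (a + 1))) <= x / 2 by lra.
have -> : a * (x / (2 * (a + 1))) = (x / 2) * (a / (a + 1)).
  by field; apply/eqP; lra.
rewrite ler_piMr//; first by rewrite divr_ge0// ltW.
by rewrite ler_pdivrMr; lra.
Qed.

Lemma integrable_gamma_ker (R : realType) (a : R) : 0 <= a ->
  (@lebesgue_measure R).-integrable `]0, +oo[%classic (EFin \o gamma_ker a).
Proof.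
move=> /gamma_ker_le_exp[C C0 hC].
apply: (@le_integrable _ _ _ (@lebesgue_measure R) _ (measurable_itv _) _
  (fun x => (2 * C)%:E * (exponential_pdf 2^-1 x)%:E)%E).
- by apply/measurable_EFinP/measurable_funTS; exact: measurable_gamma_ker.
- move=> x /=; rewrite in_itv/= andbT => x0.
  rewrite lee_fin exponential_pdfE ?(ltW x0)//.
  rewrite ger0_norm ?gamma_ker_ge0// ger0_norm; last first.
    by rewrite !mulr_ge0 ?(ltW C0) ?expR_ge0.
  apply: (le_trans (hC _ x0)).
  rewrite (_ : - 2^-1 * x = - (x / 2)); last by field.
  by apply: eq_ler; field.
- apply: (@integrableZl _ _ R (@lebesgue_measure R) _ (measurable_itv _) (2 * C)
    (EFin \o exponential_pdf 2^-1)).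
  have := @integrable_exponential_pdf R 2^-1; rewrite invr_gt0 => /(_ (ltr0Sn _ 1)).
  by apply: integrableS => //; exact: measurable_itv.
Qed.

Lemma cvg_gamma_ker_pinfty (R : realType) (a : R) : 0 <= a ->
  (gamma_ker a x @[x --> +oo] --> 0)%classic.
Proof.
move=> /gamma_ker_le_exp[C C0 hC].
apply: (@squeeze_cvgr _ _ _ _ (fun=> 0) (fun x => C * expR (- (x / 2)))).
- near=> x; rewrite gamma_ker_ge0/= hC//; near: x; exact: nbhs_pinfty_gt.
- exact: cvg_cst.
- rewrite -[X in _ --> X](mulr0 C); apply: cvgM; first exact: cvg_cst.
  apply: (@cvg_comp _ _ _ (fun x => x / 2) (fun z => expR (- z)) _ (pinfty_nbhs R)).
    apply: (@gt0_cvgMly _ _ _ 2^-1 id); first by rewrite invr_gt0 ltr0Sn.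
    exact: cvg_id.
  exact: cvgr_expR.
Unshelve. all: by end_near. Qed.

Lemma cvg_gamma_ker_0 (R : realType) (a : R) : 0 <= a ->
  (gamma_ker a x @[x --> 0^'+] --> gamma_ker a 0)%classic.
Proof.
move=> a0; apply: cvgM; last first.
  apply: cvg_at_right_filter.
  apply: continuous_comp; last exact: continuous_expR.
  exact: (@continuousN _ R^o).
move: a0; rewrite le_eqVlt => /predU1P[<-|a0].
  by rewrite powRr0; under eq_fun do rewrite powRr0; exact: cvg_cst.
by rewrite powR0 ?gt_eqF//; exact: powR_cvg0.
Qed.

Lemma is_derive_gamma_ker (R : realType) (a x : R) : 0 < x ->
  is_derive x 1 (gamma_ker a) (gamma_ker a x * (a * x^-1 - 1)).
Proof.
move=> x0; have dp := @is_derive1_powR _ a x x0.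
have dN : is_derive x (1 : R) (fun y : R => expR (- y)) (- expR (- x)).
  have d1 : is_derive x (1 : R) (expR \o (fun y : R => - y)) (expR (- x) * -1).
    exact: is_derive1_comp.
  by rewrite mulrN1 in d1.
have dM := is_deriveM dp dN.
rewrite -[_ * _]/(gamma_ker a) in dM.
apply: (is_derive_eq dM).
rewrite /gamma_ker powRB ?(gt_eqF x0) ?implybT// powRr1 ?ltW//= !scalerAl /GRing.scale/=.
by field; rewrite gt_eqF.
Qed.

Lemma continuous_gamma_ker (R : realType) (a x : R) : 0 < x ->
  {for x, continuous (gamma_ker a)}.
Proof.
by move=> x0; exact: is_derive_continuous (is_derive_gamma_ker a x0).
Qed.

(** The functional equation of the Gamma function.  The difference of the two
    integrands is the derivative of x^(a+1) e^(-x); it is nonnegative before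
    a + 1 and nonpositive after, which lets the fundamental theorem be applied
    on each side without any exchange of limits. *)
Lemma Rintegral_gamma_kerS (R : realType) (a : R) : 0 <= a ->
  \int[@lebesgue_measure R]_(x in `]0, +oo[) gamma_ker (a + 1) x =
  (a + 1) * \int[@lebesgue_measure R]_(x in `]0, +oo[) gamma_ker a x.
Proof.
move=> a0; have a1 : 0 <= a + 1 by lra.
pose f x := (a + 1) * gamma_ker a x - gamma_ker (a + 1) x.
have ia : (@lebesgue_measure R).-integrable `]0, +oo[%classic
    (EFin \o (fun x => (a + 1) * gamma_ker a x)).
  apply: (@integrableZl _ _ R (@lebesgue_measure R) _ (measurable_itv _) (a + 1)
    (EFin \o gamma_ker a)).
  exact: integrable_gamma_ker.
have ia1 := integrable_gamma_ker a1.
have if_ : (@lebesgue_measure R).-integrable `]0, +oo[%classic (EFin \o f).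
  exact: (@integrableB _ _ R (@lebesgue_measure R) _ (measurable_itv _) _ _ ia ia1).
have df (x : R) : 0 < x -> is_derive x (1:R) (gamma_ker (a + 1)) (f x).
  move=> x0; apply: is_derive_eq; first exact: is_derive_gamma_ker.
  by rewrite /f gamma_kerS//; field; rewrite gt_eqF.
have cf (x : R) : 0 < x -> {for x, continuous f}.
  move=> x0; rewrite /f; apply: (@continuousB _ R^o).
    apply: (@continuousM _ R^o) => //; first exact: cvg_cst.
    exact: continuous_gamma_ker.
  exact: continuous_gamma_ker.
suff : \int[@lebesgue_measure R]_(x in `]0, +oo[) f x = 0.
  rewrite /f RintegralB//.
  move=> /eqP; rewrite subr_eq0 => /eqP <-.
  by rewrite RintegralZl//; exact: integrable_gamma_ker.
have b0 : 0 < a + 1 by lra.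
have b0' : `]0, +oo[%classic = `]0, a + 1] `|` `]a + 1, +oo[ :> set R.
  by rewrite -(@itv_bndbnd_setU _ _ _ (BRight (a + 1)))// bnd_simp ltW.
rewrite b0' in if_ *; rewrite Rintegral_setU//=; last first.
  apply/disj_setPS => x /= [/[!in_itv]/= /andP[_ xa] /andP[ax _]].
  by rewrite ltNge xa in ax.
have wcf : {within `[0, a + 1], continuous f}.
  apply/continuous_within_itvP => //; split.
  - by move=> x /[!in_itv]/= /andP[x0 _]; exact: cf.
  - rewrite /f; apply: cvgB; last exact: cvg_gamma_ker_0.
    by apply: cvgM; [exact: cvg_cst|exact: cvg_gamma_ker_0].
  - by apply: cvg_at_left_filter; exact: cf.
have -> : \int[@lebesgue_measure R]_(x in `]0, a + 1]) f x = gamma_ker (a + 1) (a + 1).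
  rewrite Rintegral_itv_obnd_cbnd; last first.
    by apply: integrableS (@subsetUl _ _ _) if_; first exact: measurableU.
  rewrite /Rintegral (@continuous_FTC2 _ f (gamma_ker (a + 1)))//=.
  - by rewrite /gamma_ker powR0 ?mul0r ?subr0// gt_eqF.
  - split.
    + by move=> x /[!in_itv]/= /andP[x0 _]; case: (df x x0).
    + exact: cvg_gamma_ker_0.
    + apply: cvg_at_left_filter.
      exact: continuous_gamma_ker.
  - by move=> x /[!in_itv]/= /andP[x0 _]; rewrite derive1E; case: (df x x0).
rewrite Rintegral_itv_obnd_cbnd; last first.
  by apply: integrableS (@subsetUr _ _ _) if_; first exact: measurableU.
rewrite /Rintegral (@le0_continuous_FTC2y _ f (gamma_ker (a + 1)) _ 0)//=.
- by rewrite sub0r subrr.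
- move=> x xa; have x0 := lt_le_trans b0 xa.
  by rewrite /f gamma_kerS// -mulrBl mulr_le0_ge0 ?gamma_ker_ge0// subr_le0.
- apply/continuous_within_itvcyP; split.
    by move=> x /[!in_itv]/= /andP[x0 _]; apply: cf; exact: lt_trans x0.
  by apply: cvg_at_right_filter; exact: cf.
- exact: cvg_gamma_ker_pinfty.
- apply: cvg_at_right_filter.
  exact: continuous_gamma_ker.
- by move=> x xa; case: (df x (lt_trans b0 xa)).
- by move=> x /[!in_itv]/= /andP[xa _]; rewrite derive1E; case: (df x (lt_trans b0 xa)).
Qed.

(** * Polynomial moments and tails of the kernel *)

Lemma gamma_ker_monomial (R : realType) (a x : R) (n : nat) : 0 < x ->
  x ^+ n * gamma_ker a x = gamma_ker (a + n%:R) x.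
Proof.
move=> x0; elim: n => [|n IH]; first by rewrite expr0 mul1r addr0.
by rewrite exprS -mulrA IH -gamma_kerS// -addrA -[n.+1]addn1 natrD.
Qed.

Lemma integrable_monomial_gamma_ker (R : realType) (a : R) (n : nat) : 0 <= a ->
  (@lebesgue_measure R).-integrable `]0, +oo[
    (EFin \o (fun x => x ^+ n * gamma_ker a x)).
Proof.
move=> a0; have : 0 <= a + n%:R by rewrite addr_ge0.
move=> /integrable_gamma_ker; apply: eq_integrable => //.
by move=> x /[!inE]/= /[!in_itv]/= /andP[x0 _]; rewrite gamma_ker_monomial.
Qed.

Lemma Rintegral_monomial_gamma_ker (R : realType) (a : R) (n : nat) : 0 <= a ->
  \int[@lebesgue_measure R]_(x in `]0, +oo[) (x ^+ n * gamma_ker a x) =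
  \prod_(j < n) (a + 1 + j%:R) *
  \int[@lebesgue_measure R]_(x in `]0, +oo[) gamma_ker a x.
Proof.
move=> a0; elim: n => [|n IH].
  by rewrite big_ord0 mul1r; apply: eq_Rintegral => x _; rewrite expr0 mul1r.
rewrite big_ord_recr/= mulrAC -IH.
transitivity (\int[@lebesgue_measure R]_(x in `]0, +oo[) gamma_ker (a + n%:R + 1) x).
  apply: eq_Rintegral => x /[!inE]/= /[!in_itv]/= /andP[x0 _].
  by rewrite gamma_ker_monomial// -addrA -[n.+1]addn1 natrD.
rewrite Rintegral_gamma_kerS ?addr_ge0// mulrC; congr (_ * _); last by ring.
apply: eq_Rintegral => x /[!inE]/= /[!in_itv]/= /andP[x0 _].
by rewrite gamma_ker_monomial.
Qed.

Lemma integrable_poly_gamma_ker (R : realType) (a : R) (n : nat) (c : nat -> R) :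
  0 <= a ->
  (@lebesgue_measure R).-integrable `]0, +oo[
    (EFin \o (fun x => (\sum_(i < n) c i * x ^+ i) * gamma_ker a x)).
Proof.
move=> a0; elim: n => [|n IH].
  apply: eq_integrable (integrable0 _ _) => // x _ /=.
  by rewrite big_ord0 mul0r.
have H := @integrableZl _ _ R (@lebesgue_measure R) _ (measurable_itv _) (c n) _
  (integrable_monomial_gamma_ker n a0).
apply: eq_integrable (@integrableD _ _ R (@lebesgue_measure R) _ (measurable_itv _) _ _ IH H) => //.
by move=> x _; rewrite /= big_ord_recr/= mulrDl EFinD -!mulrA !EFinM.
Qed.

Lemma Rintegral_poly_gamma_ker (R : realType) (a : R) (n : nat) (c : nat -> R) :
  0 <= a ->
  \int[@lebesgue_measure R]_(x in `]0, +oo[) ((\sum_(i < n) c i * x ^+ i) * gamma_ker a x)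
  = (\sum_(i < n) c i * \prod_(j < i) (a + 1 + j%:R)) *
    \int[@lebesgue_measure R]_(x in `]0, +oo[) gamma_ker a x.
Proof.
move=> a0; elim: n => [|n IH].
  rewrite big_ord0 mul0r; under eq_Rintegral do rewrite big_ord0 mul0r.
  by rewrite Rintegral_cst// mul0r.
rewrite big_ord_recr/= mulrDl -IH -mulrA -Rintegral_monomial_gamma_ker//.
have im := integrable_monomial_gamma_ker n a0.
rewrite -RintegralZl//.
have im' := @integrableZl _ _ R (@lebesgue_measure R) _ (measurable_itv _) (c n) _ im.
rewrite -RintegralD//; last exact: integrable_poly_gamma_ker.
by apply: eq_Rintegral => x _; rewrite big_ord_recr/= mulrDl !mulrA.
Qed.

Lemma le_Rintegral_subset (R : realType) (A D : set (measurableTypeR R)) (f g : R -> R) :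
  measurable A -> measurable D -> A `<=` D ->
  (@lebesgue_measure R).-integrable D (EFin \o f) ->
  (@lebesgue_measure R).-integrable A (EFin \o g) ->
  (forall x, D x -> 0 <= f x) -> (forall x, A x -> g x <= f x) ->
  \int[@lebesgue_measure R]_(x in A) g x <= \int[@lebesgue_measure R]_(x in D) f x.
Proof.
move=> mA mD AD fD gA f0 gf.
have fA : (@lebesgue_measure R).-integrable A (EFin \o f).
  exact: (integrableS mD mA AD fD).
apply: (@le_trans _ _ (\int[@lebesgue_measure R]_(x in A) f x)).
  exact: le_Rintegral.
rewrite /Rintegral fine_le//.
- exact: (integrable_fin_num mA fA).
- exact: (integrable_fin_num mD fD).
- apply: ge0_subset_integral => //; first by case/integrableP : fD.
Qed.

(** The hypothesis says that y is reached from x by moving towards the mode a,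
    that is x <= y <= a or a <= y <= x. *)
Lemma gamma_ker_monotone (R : realType) (a x y : R) : 0 <= a -> 0 < x -> 0 < y ->
  (y - x) * (a - y) >= 0 -> gamma_ker a x <= gamma_ker a y.
Proof.
move=> a0 x0 y0 h; rewrite !gamma_kerE// ler_expR.
have l1 : ln x - ln y <= x / y - 1.
  rewrite -ln_div ?posrE//.
  have := @le_ln1Dx R (x / y - 1); rewrite addrCA subrr addr0; apply.
  by rewrite ltrBrDl subrr divr_gt0.
have l2 : a * (ln x - ln y) <= a * (x / y - 1) by rewrite ler_wpM2l.
have l3 : a * (x / y - 1) - (x - y) = - ((y - x) * (a - y) / y).
  by field; rewrite gt_eqF.
have l4 : 0 <= (y - x) * (a - y) / y by rewrite divr_ge0// ltW.
lra.
Qed.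

(** Beyond the mode the kernel decreases more slowly than e^(-x):
    minus its derivative is the kernel times 1 - a / x <= 1, and integrates
    to the value at r. *)
Lemma gamma_ker_le_tail (R : realType) (a r : R) : 0 <= a -> 0 < r -> a <= r ->
  gamma_ker a r <= \int[@lebesgue_measure R]_(x in `]r, +oo[) gamma_ker a x.
Proof.
move=> a0 r0 ar.
have dg (x : R) : r <= x ->
    is_derive x (1:R) (fun y => - gamma_ker a y) (gamma_ker a x * (1 - a * x^-1)).
  move=> rx; have x0 := lt_le_trans r0 rx.
  have := is_deriveN (is_derive_gamma_ker a x0).
  rewrite (_ : - (gamma_ker a x * _) = gamma_ker a x * (1 - a * x^-1)) //; ring.
have cg (x : R) : r <= x -> {for x, continuous (fun y => gamma_ker a y * (1 - a * y^-1))}.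
  move=> rx; have x0 := lt_le_trans r0 rx.
  apply: (@continuousM _ R^o).
    exact: continuous_gamma_ker.
  apply: (@continuousB _ R^o); first exact: cvg_cst.
  apply: (@continuousM _ R^o); first exact: cvg_cst.
  by apply: (@continuousV _ R^o) => //; rewrite gt_eqF.
have igr : (@lebesgue_measure R).-integrable `]r, +oo[ (EFin \o gamma_ker a).
  apply: integrableS (integrable_gamma_ker a0) => //.
  by apply: subset_itvr; rewrite bnd_simp ltW.
have <- : \int[@lebesgue_measure R]_(x in `[r, +oo[) (gamma_ker a x * (1 - a * x^-1))
    = gamma_ker a r.
  rewrite (@Rintegral_ge0_continuous_FTC2y _ _ (fun y => - gamma_ker a y) _ 0).
  - by rewrite sub0r opprK.
  - move=> x rx; have x0 := lt_le_trans r0 rx.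
    rewrite mulr_ge0 ?gamma_ker_ge0// subr_ge0 ler_pdivrMr// mul1r.
    exact: le_trans rx.
  - apply/continuous_within_itvcyP; split.
      by move=> x /[!in_itv]/= /andP[x0 _]; apply: cg; exact: ltW.
    by apply: cvg_at_right_filter; exact: cg.
  - by rewrite -oppr0; apply: cvgN; exact: cvg_gamma_ker_pinfty.
  - by move=> x rx; case: (dg x (ltW rx)).
  - apply: cvg_at_right_filter; apply: cvgN.
    exact: continuous_gamma_ker.
  - by move=> x /[!in_itv]/= /andP[xa _]; rewrite derive1E; case: (dg x (ltW xa)).
have hle : forall x, `]r, +oo[%classic x -> 0 <= gamma_ker a x * (1 - a * x^-1) <= gamma_ker a x.
  move=> x /=; rewrite in_itv/= andbT => rx; have x0 := lt_trans r0 rx.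
  rewrite mulr_ge0 ?gamma_ker_ge0//=; last first.
    rewrite subr_ge0 ler_pdivrMr// mul1r.
    exact: le_trans (ltW rx).
  by rewrite ler_piMr ?gamma_ker_ge0// lerBlDr lerDl divr_ge0// ltW.
have ig : (@lebesgue_measure R).-integrable `]r, +oo[
    (EFin \o (fun x => gamma_ker a x * (1 - a * x^-1))).
  apply: (@le_integrable _ _ _ (@lebesgue_measure R) _ (measurable_itv _) _ (EFin \o gamma_ker a)) igr.
    apply/measurable_EFinP; apply: open_continuous_measurable_fun.
      exact: interval_open.
    move=> x /[!inE]/= /[!in_itv]/= /andP[rx _]; apply: cg; exact: ltW.
  move=> x /hle/andP[h1 h2]; rewrite lee_fin ger0_norm// ger0_norm//.
  exact: gamma_ker_ge0.
rewrite -Rintegral_itv_obnd_cbnd//; apply: le_Rintegral => //.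
by move=> x /hle/andP[].
Qed.

(** * Pointwise bounds on the kernel by the Gamma function *)

Lemma Gamma_funE (R : realType) (a : R) :
  Gamma_fun (a + 1) = \int[@lebesgue_measure R]_(x in `]0, +oo[) gamma_ker a x.
Proof. by rewrite /Gamma_fun addrK. Qed.

Lemma Gamma_funS (R : realType) (u : R) : 1 <= u ->
  Gamma_fun (u + 1) = u * Gamma_fun u.
Proof.
move=> u1; have u0 : 0 <= u - 1 by lra.
rewrite -{3}(subrK 1 u) Gamma_funE -{1}(subrK 1 u) Gamma_funE Rintegral_gamma_kerS//.
by rewrite subrK.
Qed.

Lemma integrable_gamma_ker_sub (R : realType) (a : R) (i : interval R) : 0 <= a ->
  [set` i] `<=` `]0, +oo[%classic ->
  (@lebesgue_measure R).-integrable [set` i] (EFin \o gamma_ker a).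
Proof.
move=> a0 i0.
have := integrable_gamma_ker a0; apply: integrableS => //; exact: measurable_itv.
Qed.

(** The kernel is at least its value at x between x and the mode a, an
    interval of length |x - a|, and the tail beyond that interval contributes
    at least that value once more. *)
Lemma gamma_ker_peak_le_Gamma (R : realType) (a x : R) : 0 <= a -> 0 < x ->
  gamma_ker a x * (`|x - a| + 1) <= Gamma_fun (a + 1).
Proof.
move=> a0 x0; rewrite Gamma_funE.
pose l := Num.min x a; pose r := Num.max x a.
have r0 : 0 < r by rewrite lt_max x0.
have l0 : 0 <= l by rewrite le_min (ltW x0).
have lr : l <= r by rewrite ge_min le_max lexx.
have -> : `|x - a| = r - l.
  rewrite /r /l; have [xa|xa] := leP x a.
    by rewrite ler0_norm ?subr_le0// opprB.
  by rewrite gtr0_norm// subr_gt0.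
have glr y : l < y <= r -> gamma_ker a x <= gamma_ker a y.
  move=> /andP[ly yr]; apply: gamma_ker_monotone => //; first exact: le_lt_trans ly.
  move: ly yr; rewrite /r /l; have [xa|xa] := leP x a => ly yr.
    by rewrite mulr_ge0// subr_ge0// ltW.
  by rewrite mulr_le0// subr_le0// ltW.
have ilr : (@lebesgue_measure R).-integrable `]l, r] (EFin \o gamma_ker a).
  apply: integrable_gamma_ker_sub => // y /=; rewrite !in_itv/= => /andP[ly _].
  by rewrite andbT; exact: le_lt_trans ly.
have ir : (@lebesgue_measure R).-integrable `]r, +oo[ (EFin \o gamma_ker a).
  apply: integrable_gamma_ker_sub => // y /=; rewrite !in_itv/= !andbT; exact: lt_trans.
have iloo : (@lebesgue_measure R).-integrable `]l, +oo[ (EFin \o gamma_ker a).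
  apply: integrable_gamma_ker_sub => // y /=; rewrite !in_itv/= !andbT; exact: le_lt_trans.
apply: (@le_trans _ _ (\int[@lebesgue_measure R]_(x in `]l, +oo[) gamma_ker a x)); last first.
  apply: le_Rintegral_subset => //.
  - by move=> y /=; rewrite !in_itv/= !andbT; exact: le_lt_trans.
  - exact: integrable_gamma_ker.
  - by move=> y _; exact: gamma_ker_ge0.
have := @Rintegral_itvB _ (gamma_ker a) (BRight l) +oo%O r iloo.
rewrite !bnd_simp => /(_ lr isT)/eqP; rewrite subr_eq => /eqP ->.
rewrite mulrDr mulr1 addrC; apply: lerD.
  apply: le_trans (gamma_ker_le_tail a0 r0 _); last by rewrite le_max lexx orbT.
  have [xr|xr] := eqVneq x r; first by rewrite -xr.
  apply: glr; rewrite lexx andbT; move: xr; rewrite /r /l.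
  have [xa xna|] := leP x a; last by rewrite eqxx.
  by rewrite lt_neqAle xna.
have -> : gamma_ker a x * (r - l) =
    \int[@lebesgue_measure R]_(y in `]l, r]) cst (gamma_ker a x) y.
  rewrite Rintegral_cst//= lebesgue_measure_itv/= lte_fin.
  by case: ltgtP lr => //= -> _; rewrite subrr.
apply: le_Rintegral => //.
- have : (@lebesgue_measure R).-integrable `[l, r] (EFin \o cst (gamma_ker a x)).
    apply: continuous_compact_integrable; first exact: segment_compact.
    by apply: continuous_subspaceT => y; exact: cvg_cst.
  by apply: integrableS => //; exact: subset_itv_oc_cc.
Qed.

(** The gamma law of shape a + 1 has mean and variance a + 1.  On an interval
    [l, r] lying between x and the mode, the kernel is at least its value at x,
    so the second moment about the mean is at least that value times the
    integral of (y - (a + 1))^2 over [l, r]. *)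
Lemma gamma_ker_cubic_le_Gamma (R : realType) (a x l r : R) : 0 <= a ->
  0 < x -> 0 < l -> l <= r ->
  (forall y, l <= y <= r -> 0 <= (y - x) * (a - y)) ->
  gamma_ker a x * ((r - (a + 1)) ^+ 3 - (l - (a + 1)) ^+ 3) <=
  3 * (a + 1) * Gamma_fun (a + 1).
Proof.
move=> a0 x0 l0 lr h.
(* the coefficients of (y - (a + 1))^2 *)
pose c (i : nat) := nth 0 [:: (a + 1) ^+ 2; - (2 * (a + 1)); 1] i.
have cE y : \sum_(i < 3) c i * y ^+ i = (y - (a + 1)) ^+ 2.
  by rewrite !big_ord_recr/= big_ord0 /c/=; ring.
have H : \int[@lebesgue_measure R]_(y in `]0, +oo[) ((y - (a + 1)) ^+ 2 * gamma_ker a y)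
     = (a + 1) * Gamma_fun (a + 1).
  under eq_Rintegral do rewrite -cE.
  rewrite Rintegral_poly_gamma_ker// -Gamma_funE; congr (_ * _).
  rewrite !big_ord_recr/= !big_ord0 /c/=; ring.
rewrite -mulrA -H.
have cf : continuous (fun y => gamma_ker a x * (y - (a + 1)) ^+ 2).
  move=> y; apply: (@is_derive_continuous _ _ _ (gamma_ker a x * (2 * (y - (a + 1))))).
  by apply: is_derive_eq; rewrite /GRing.scale/=; ring.
have I : \int[@lebesgue_measure R]_(y in `[l, r]) (gamma_ker a x * (y - (a + 1)) ^+ 2) =
   gamma_ker a x * ((r - (a + 1)) ^+ 3 - (l - (a + 1)) ^+ 3) / 3.
  move: lr; rewrite le_eqVlt => /predU1P[<-|lr].
    by rewrite set_itv1 Rintegral_set1 subrr mulr0 mul0r.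
  pose F (y : R) := gamma_ker a x / 3 * (y - (a + 1)) ^+ 3.
  have dF (y : R) : is_derive y (1:R) F (gamma_ker a x * (y - (a + 1)) ^+ 2).
    by apply: is_derive_eq; rewrite /GRing.scale/=; field.
  transitivity (fine ((F r)%:E - (F l)%:E)%E); last by rewrite /F/=; field.
  congr fine; apply: continuous_FTC2 => //.
  - exact: continuous_subspaceT.
  - split.
    + by move=> y _; case: (dF y).
    + by apply: cvg_at_right_filter; exact: is_derive_continuous.
    + by apply: cvg_at_left_filter; exact: is_derive_continuous.
  - by move=> y _; rewrite derive1E; case: (dF y).
have -> : gamma_ker a x * ((r - (a + 1)) ^+ 3 - (l - (a + 1)) ^+ 3) = 3 *
   \int[@lebesgue_measure R]_(y in `[l, r]) (gamma_ker a x * (y - (a + 1)) ^+ 2).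
  by rewrite I; field.
rewrite ler_pM2l//; apply: le_Rintegral_subset => //.
- by move=> y /=; rewrite !in_itv/= andbT => /andP[+ _]; exact: lt_le_trans.
- have := @integrable_poly_gamma_ker R a 3 c a0; apply: eq_integrable => //.
  by move=> y _ /=; rewrite cE.
- apply: continuous_compact_integrable; first exact: segment_compact.
  exact: continuous_subspaceT.
- by move=> y _; rewrite mulr_ge0 ?sqr_ge0 ?gamma_ker_ge0.
- move=> y /=; rewrite in_itv/= => ylr; rewrite mulrC ler_wpM2l ?sqr_ge0//.
  apply: gamma_ker_monotone => //; last exact: h.
  by case/andP: ylr => + _; exact: lt_le_trans.
Qed.

(** * Uniform bounds on the derivatives of the gamma distribution function *)

Lemma Gamma_fun_gt0 (R : realType) (u : R) : 1 <= u -> 0 < Gamma_fun u.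
Proof.
move=> u1; have u0 : 0 <= u - 1 by lra.
have := gamma_ker_peak_le_Gamma u0 ltr01; rewrite subrK; apply: lt_le_trans.
by rewrite mulr_gt0 ?gamma_ker_gt0// ltr_wpDl.
Qed.

(** The functions [gamma_cdf_d1], ..., [gamma_cdf_d4] are, on the positive
    half-line, the successive derivatives of the gamma distribution function of
    shape m + 1; the shift makes m the mode of its density. *)
Definition gamma_cdf_d1 (R : realType) (m y : R) : R := gamma_ker m y / Gamma_fun (m + 1).
Definition gamma_cdf_d2 (R : realType) (m y : R) : R := gamma_cdf_d1 m y * (m * y^-1 - 1).
Definition gamma_cdf_d3 (R : realType) (m y : R) : R :=
  gamma_cdf_d1 m y * ((m * y^-1 - 1) ^+ 2 - m * y^-1 ^+ 2).
Definition gamma_cdf_d4 (R : realType) (m y : R) : R :=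
  gamma_cdf_d1 m y * ((m * y^-1 - 1) ^+ 3 - 3 * (m * y^-1 - 1) * (m * y^-1 ^+ 2)
              + 2 * m * y^-1 ^+ 3).

Lemma is_derive_gamma_cdf_d1 (R : realType) (m y : R) : 0 < y ->
  is_derive y 1 (gamma_cdf_d1 m) (gamma_cdf_d2 m y).
Proof.
move=> y0; have dg := is_derive_gamma_ker m y0.
by apply: is_derive_eq; rewrite /gamma_cdf_d2 /gamma_cdf_d1 /GRing.scale/=; ring.
Qed.

Lemma is_derive_gamma_cdf_d2 (R : realType) (m y : R) : 0 < y ->
  is_derive y 1 (gamma_cdf_d2 m) (gamma_cdf_d3 m y).
Proof.
move=> y0; have dg := is_derive_gamma_cdf_d1 m y0.
have di := is_derive_invr y0.
apply: is_derive_eq; rewrite /gamma_cdf_d3 /gamma_cdf_d2 /GRing.scale/=.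
by ring.
Qed.

Lemma is_derive_gamma_cdf_d3 (R : realType) (m y : R) : 0 < y ->
  is_derive y 1 (gamma_cdf_d3 m) (gamma_cdf_d4 m y).
Proof.
move=> y0; have dg := is_derive_gamma_cdf_d1 m y0.
have di := is_derive_invr y0.
apply: is_derive_eq; rewrite /gamma_cdf_d4 /gamma_cdf_d2 /GRing.scale/=.
by ring.
Qed.

(** The number k is the gamma density of shape m at x; its mode is m - 1 and
    its mean m.  All later bounds are real arithmetic on these inequalities. *)
Lemma gamma_density_profile (R : realType) (m x : R) : 1 <= m -> 0 < x ->
  exists k, [/\ 0 <= k, k * (`|x - m + 1| + 1) <= 1,
    (0 <= x - m -> k * (x - m) ^+ 3 <= 3 * m),
    (x - m < -1 -> k * (- (x - m) ^+ 3 - 1) <= 3 * m) &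
    gamma_cdf_d1 m x = k * x / m].
Proof.
move=> m1 x0; have a0 : 0 <= m - 1 by lra.
have G0 : 0 < Gamma_fun m by exact: Gamma_fun_gt0.
exists (gamma_ker (m - 1) x / Gamma_fun m); split.
- by rewrite divr_ge0 ?gamma_ker_ge0// ltW.
- rewrite mulrAC ler_pdivrMr// mul1r.
  have := gamma_ker_peak_le_Gamma a0 x0; rewrite subrK.
  by rewrite (_ : x - (m - 1) = x - m + 1)//; ring.
- move=> z0; rewrite mulrAC ler_pdivrMr//.
  have := @gamma_ker_cubic_le_Gamma R (m - 1) x m x a0 x0.
  rewrite subrK subrr expr0n subr0; apply.
  + by lra.
  + by rewrite -subr_ge0.
  + by move=> y /andP[my yx]; rewrite mulr_le0//; lra.
- move=> z0; rewrite mulrAC ler_pdivrMr//.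
  have := @gamma_ker_cubic_le_Gamma R (m - 1) x x (m - 1) a0 x0 x0.
  rewrite subrK (_ : (m - 1 - m) ^+ 3 = - 1); last by ring.
  rewrite (addrC (- 1)); apply; first by lra.
  by move=> y /andP[my yx]; rewrite mulr_ge0//; lra.
- rewrite /gamma_cdf_d1 Gamma_funS// -{1}(subrK 1 m) gamma_kerS//; field.
  by rewrite !gt_eqF//; lra.
Qed.

Lemma gamma_cdf_d1_ge0 (R : realType) (m x : R) : 0 <= m -> 0 <= gamma_cdf_d1 m x.
Proof. by move=> m0; rewrite divr_ge0 ?gamma_ker_ge0// ltW// Gamma_fun_gt0//; lra. Qed.

Lemma gamma_cdf_d1_peak (R : realType) (m x : R) : 0 <= m -> 0 < x ->
  gamma_cdf_d1 m x * (`|x - m| + 1) <= 1.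
Proof.
move=> m0 x0; have m10 : 1 <= m + 1 by lra.
by rewrite /gamma_cdf_d1 mulrAC ler_pdivrMr ?Gamma_fun_gt0// mul1r gamma_ker_peak_le_Gamma.
Qed.

Lemma gamma_cdf_d1_le1 (R : realType) (m x : R) : 0 <= m -> 0 < x -> gamma_cdf_d1 m x <= 1.
Proof.
move=> m0 x0; apply: le_trans (gamma_cdf_d1_peak m0 x0).
by rewrite ler_peMr ?gamma_cdf_d1_ge0// lerDr.
Qed.

Lemma gamma_cdf_d2_le1 (R : realType) (m x : R) : 1 <= m -> 0 < x -> gamma_cdf_d2 m x <= 1.
Proof.
move=> m1 x0; have [k [k0 kp _ _ fE]] := gamma_density_profile m1 x0.
have m0 : 0 < m by lra.
have k1 : k <= 1 by apply: le_trans kp; rewrite ler_peMr// lerDr.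
have -> : gamma_cdf_d2 m x = k * (m - x) / m.
  by rewrite /gamma_cdf_d2 fE; field; rewrite !gt_eqF.
rewrite ler_pdivrMr// mul1r.
have h1 : 0 <= k * x by rewrite mulr_ge0// ltW.
have h2 : k * m <= m by rewrite ler_piMl// ltW.
lra.
Qed.

(** Here the density f of shape m + 1 itself is used, with mode m: for
    z = x - m >= 0, - F'' = f z / x <= z / ((m + z) (1 + z)) <= z / (1 + z)^2. *)
Lemma gamma_cdf_d2_ge (R : realType) (m x : R) : 1 <= m -> 0 < x -> - 4^-1 <= gamma_cdf_d2 m x.
Proof.
move=> m1 x0; have m0 : 0 <= m by lra.
have f0 := gamma_cdf_d1_ge0 x m0.
have -> : gamma_cdf_d2 m x = - (gamma_cdf_d1 m x * (x - m) / x).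
  by rewrite /gamma_cdf_d2; field; rewrite gt_eqF.
rewrite lerN2 ler_pdivrMr//.
have [z0|z0] := leP 0 (x - m); last first.
  apply: (@le_trans _ _ 0); first by rewrite mulr_ge0_le0// ltW.
  by rewrite mulr_ge0// ltW.
have h := gamma_cdf_d1_peak m0 x0; rewrite ger0_norm// in h.
set f := gamma_cdf_d1 m x in h f0 *; set z := x - m in z0 h *.
have xE : x = m + z by rewrite /z; ring.
rewrite xE.
have h1 : f * z * (z + 1) <= z by rewrite mulrAC -[leRHS]mul1r ler_wpM2r.
have h2 : 4 * z <= (1 + z) * (z + 1).
  by rewrite -subr_ge0 (_ : _ - _ = (z - 1) ^+ 2) ?sqr_ge0//; ring.
have : 4 * (f * z) * (z + 1) <= (1 + z) * (z + 1) by lra.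
rewrite ler_pM2r; last by lra.
lra.
Qed.

(** Up to the factor k this is z^2 / m - 1.  The quadratic term is interpolated
    between the linear and cubic bounds of [gamma_density_profile] by the
    arithmetic-geometric mean inequality; the weight 7/4 approximates the
    optimal sqrt 3. *)
Lemma gamma_cdf_d3_bound (R : realType) (m x : R) : 1 <= m -> 0 < x ->
  `|x * gamma_cdf_d3 m x| <= 7 / 4.
Proof.
move=> m1 x0; have [k [k0 kp cr cl fE]] := gamma_density_profile m1 x0.
have m0 : 0 < m by lra.
have -> : x * gamma_cdf_d3 m x = k * (x - m) ^+ 2 / m - k.
  by rewrite /gamma_cdf_d3 fE; field; rewrite !gt_eqF.
have k1 : k <= 1 by apply: le_trans kp; rewrite ler_peMr// lerDr.
set z := x - m in kp cr cl *.
have kz2 : 0 <= k * z ^+ 2 / m.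
  by apply: divr_ge0; [apply: mulr_ge0 => //; exact: sqr_ge0|exact: ltW].
have im : m^-1 <= 1 by rewrite invf_le1.
have im0 : 0 <= m^-1 by rewrite invr_ge0 ltW.
have amgm w : 0 <= k * w ->
    k * w ^+ 2 / m <= (7 / 4 * (k * w) + 4 / 7 * (k * w ^+ 3 / m)) / 2.
  move=> kw; rewrite -subr_ge0.
  have -> : (7 / 4 * (k * w) + 4 / 7 * (k * w ^+ 3 / m)) / 2 - k * w ^+ 2 / m =
      k * w * (2 / 7) * ((w - 7 / 4) ^+ 2 * m^-1 + (7 / 4) ^+ 2 * (1 - m^-1)).
    by field; rewrite gt_eqF.
  apply: mulr_ge0; first by apply: mulr_ge0 => //; lra.
  by apply: addr_ge0; apply: mulr_ge0; rewrite ?sqr_ge0//; lra.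
rewrite ler_norml; apply/andP; split; first by lra.
have [z0|z0] := leP 0 z.
  have := cr z0; rewrite -ler_pdivrMr// => c3.
  move: kp; rewrite ger0_norm; last by lra.
  move=> kp.
  have kz : k * z <= 1 by nra.
  have := amgm z (mulr_ge0 k0 z0).
  by lra.
have [z1|z1] := leP (-1) z.
  have : k * z ^+ 2 / m <= k.
    rewrite -mulrA ler_piMr// ler_pdivrMr// mul1r.
    nra.
  by lra.
have := cl z1; rewrite -ler_pdivrMr// => c3.
move: kp; rewrite ltr0_norm; last by lra.
move=> kp.
have kz : k * (- z) <= 1 by lra.
have kim : k * m^-1 <= k by rewrite ler_piMr.
have c3' : k * (- z) ^+ 3 / m <= 3 + k.
  by rewrite (_ : (- z) ^+ 3 = - z ^+ 3); [lra|ring].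
have := amgm (- z); rewrite sqrrN => /(_ _)/le_trans; rewrite lerBlDr; apply.
  by rewrite mulr_ge0//; lra.
lra.
Qed.

(** Up to the factor k this is - z^3 / m + 3 z + 2.  For z >= 0 the terms have
    opposite signs, so each is bounded separately; for z < -1 the linear term
    absorbs the defect in the cubic bound. *)
Lemma gamma_cdf_d4_bound (R : realType) (m x : R) : 1 <= m -> 0 < x ->
  `|x ^+ 2 * gamma_cdf_d4 m x| <= 3.
Proof.
move=> m1 x0; have [k [k0 kp cr cl fE]] := gamma_density_profile m1 x0.
have m0 : 0 < m by lra.
have -> : x ^+ 2 * gamma_cdf_d4 m x = - (k * (x - m) ^+ 3 / m) + 3 * (k * (x - m)) + 2 * k.
  by rewrite /gamma_cdf_d4 fE; field; rewrite !gt_eqF.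
have k1 : k <= 1 by apply: le_trans kp; rewrite ler_peMr// lerDr.
set z := x - m in kp cr cl *.
have im : m^-1 <= 1 by rewrite invf_le1.
have im0 : 0 <= m^-1 by rewrite invr_ge0 ltW.
have kim : k * m^-1 <= k by rewrite ler_piMr.
rewrite ler_norml.
have [z0|z0] := leP 0 z.
  have := cr z0; rewrite -ler_pdivrMr// => c3.
  move: kp; rewrite ger0_norm; last by lra.
  move=> kp.
  have c30 : 0 <= k * z ^+ 3 / m by rewrite !mulr_ge0// exprn_ge0.
  have kz : 0 <= k * z by rewrite mulr_ge0.
  by apply/andP; split; lra.
have [z1|z1] := leP (-1) z.
  have kz : - k <= k * z by nra.
  have kz0 : k * z <= 0 by nra.
  have z2 : 0 <= z ^+ 2 <= 1 by apply/andP; split; nra.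
  have z3 : 0 <= - (k * z ^+ 3) <= - (k * z).
    rewrite (_ : - (k * z ^+ 3) = - (k * z) * z ^+ 2); last by ring.
    by case/andP: z2 => z2 z21; apply/andP; split; nra.
  have z3m : 0 <= - (k * z ^+ 3) / m <= - (k * z).
    case/andP: z3 => z3 z31; apply/andP; split; first by rewrite mulr_ge0.
    by apply: le_trans z31; rewrite ler_piMr.
  by apply/andP; split; lra.
have := cl z1; rewrite -ler_pdivrMr// => c3.
move: kp; rewrite ltr0_norm; last by lra.
move=> kp.
have kz : k * (- z) <= 1 by lra.
have kz1 : k <= k * (- z) by nra.
have c30 : 0 <= k * (- z) ^+ 3 / m by do 2![apply: mulr_ge0 => //]; apply: exprn_ge0; lra.
rewrite (_ : (- z) ^+ 3 = - z ^+ 3) in c30; last by ring.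
by apply/andP; split; lra.
Qed.

(** * Taylor inequalities on the positive half-line *)

(** The form of the mean value theorem used to propagate signs: the
    intermediate point lies strictly on the same side of K as y. *)
Lemma MVT_positive (R : realType) (g g' : R -> R) (K y : R) :
  (forall x : R, 0 < x -> is_derive x 1 g (g' x)) -> 0 < K -> 0 < y -> y != K ->
  exists c, [/\ 0 < c, 0 < (y - K) * (c - K) & g y - g K = g' c * (y - K)].
Proof.
move=> dg K0 y0 yneK.
have cg (a b : R) : 0 < a -> {within `[a, b], continuous g}.
  move=> a0; apply: continuous_in_subspaceT => x /[!inE]/= /[!in_itv]/= /andP[ax _].
  apply/differentiable_continuous/derivable1_diffP.
  by case: (dg x (lt_le_trans a0 ax)).
have dg' (a b : R) : 0 < a -> forall x, x \in `]a, b[ -> is_derive x 1 g (g' x).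
  by move=> a0 x /[!in_itv]/= /andP[ax _]; apply: dg; exact: lt_trans ax.
have [yK|Ky|yK] := ltgtP y K; last by rewrite yK eqxx in yneK.
  have [c + E] := MVT yK (dg' _ _ y0) (cg _ _ y0).
  rewrite in_itv/= => /andP[yc cK]; exists c; split => //.
  - exact: lt_trans yc.
  - by rewrite nmulr_rgt0 subr_lt0.
  - by rewrite -opprB E -mulrN opprB.
have [c + E] := MVT Ky (dg' _ _ K0) (cg _ _ K0).
rewrite in_itv/= => /andP[Kc cy]; exists c; split => //.
  exact: lt_trans Kc.
by rewrite mulr_gt0// subr_gt0.
Qed.

Lemma ge0_of_derive_sign (R : realType) (g g' : R -> R) (K : R) :
  (forall x : R, 0 < x -> is_derive x 1 g (g' x)) -> 0 < K -> g K = 0 ->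
  (forall x, 0 < x -> 0 <= (x - K) * g' x) ->
  forall y, 0 < y -> 0 <= g y.
Proof.
move=> dg K0 gK sg y y0.
have [->|yK] := eqVneq y K; first by rewrite gK.
have [c [c0 sc E]] := MVT_positive dg K0 y0 yK.
rewrite gK subr0 in E; rewrite E.
have cK2 : 0 < (c - K) ^+ 2.
  by rewrite exprn_even_gt0//=; apply: contraTneq sc => ->; rewrite mulr0 ltxx.
rewrite -(pmulr_lge0 _ cK2).
have -> : g' c * (y - K) * (c - K) ^+ 2 = ((c - K) * g' c) * ((y - K) * (c - K)) by ring.
by rewrite mulr_ge0 ?sg// ltW.
Qed.

Lemma sign_of_derive_ge0 (R : realType) (g g' : R -> R) (K : R) :
  (forall x : R, 0 < x -> is_derive x 1 g (g' x)) -> 0 < K -> g K = 0 ->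
  (forall x, 0 < x -> 0 <= g' x) ->
  forall y, 0 < y -> 0 <= (y - K) * g y.
Proof.
move=> dg K0 gK sg y y0.
have [->|yK] := eqVneq y K; first by rewrite subrr mul0r.
have [c [c0 _ E]] := MVT_positive dg K0 y0 yK.
rewrite gK subr0 in E; rewrite E mulrCA -expr2.
by rewrite mulr_ge0 ?sqr_ge0 ?sg.
Qed.

Lemma taylor2_ge (R : realType) (F F1 F2 : R -> R) (K c : R) :
  (forall x : R, 0 < x -> is_derive x 1 F (F1 x)) ->
  (forall x : R, 0 < x -> is_derive x 1 F1 (F2 x)) ->
  0 < K -> (forall x, 0 < x -> c <= F2 x) ->
  forall y, 0 < y -> F K + F1 K * (y - K) + c / 2 * (y - K) ^+ 2 <= F y.
Proof.
move=> d1 d2 K0 cF y y0; rewrite -subr_ge0.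
pose g (x : R) := F x - (F K + F1 K * (x - K) + c / 2 * (x - K) ^+ 2).
pose g1 (x : R) := F1 x - (F1 K + c * (x - K)).
pose g2 (x : R) := F2 x - c.
apply: (@ge0_of_derive_sign _ g g1 K _ K0 _ _ y y0).
- move=> x x0; have d1x := d1 x x0.
  by apply: is_derive_eq; rewrite /g1 /GRing.scale/=; field.
- by rewrite /g; ring.
- apply: (@sign_of_derive_ge0 _ g1 g2 K _ K0).
  + move=> x x0; have d2x := d2 x x0.
    by apply: is_derive_eq; rewrite /g2 /GRing.scale/=; ring.
  + by rewrite /g1; ring.
  + by move=> x x0; rewrite subr_ge0 cF.
Qed.

(** The left-hand side is the function whose fourth derivative is 1 / y^2 and
    which vanishes to third order at K.  Divided by y^2, the difference of the
    two sides has derivative (y - K)^3 / (6 K^2 y^2), so it has its minimum 0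
    at K. *)
Lemma log_kernel_le (R : realType) (K y : R) : 0 < K -> 0 < y ->
  (y - K) ^+ 3 / (6 * K) - y ^+ 2 / 2 * (ln y - ln K) + 3 / 4 * y ^+ 2 - K * y
     + K ^+ 2 / 4
  <= (y - K) ^+ 4 / (12 * K ^+ 2).
Proof.
move=> K0 y0.
pose chi (x : R) := (12 * K ^+ 2)^-1 * x ^+ 2 - (2 * K)^-1 * x + 4^-1
  + K / 6 * x^-1 + 2^-1 * (ln x - ln K).
pose chi1 (x : R) := (x - K) ^+ 3 / (6 * K ^+ 2 * x ^+ 2).
have chi0 : 0 <= chi y.
  apply: (@ge0_of_derive_sign _ chi chi1 K _ K0 _ _ y y0).
  - move=> x x0; have dl := is_derive1_ln x0.
    have di := is_derive_invr x0.
    apply: is_derive_eq; rewrite /chi1 /GRing.scale/=.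
    by field; rewrite !gt_eqF.
  - by rewrite /chi; field; rewrite gt_eqF.
  - move=> x x0; rewrite /chi1 mulrA -exprS divr_ge0//; first exact: exprn_even_ge0.
    by apply: mulr_ge0; [apply: mulr_ge0 => //|]; exact: sqr_ge0.
rewrite -subr_ge0.
have -> : (y - K) ^+ 4 / (12 * K ^+ 2) - ((y - K) ^+ 3 / (6 * K)
     - y ^+ 2 / 2 * (ln y - ln K) + 3 / 4 * y ^+ 2 - K * y
     + K ^+ 2 / 4) = chi y * y ^+ 2.
  by rewrite /chi; field; rewrite !gt_eqF.
by rewrite mulr_ge0 ?sqr_ge0.
Qed.

(** Comparison with D times the function of [log_kernel_le]: adding it makes
    the fourth derivative nonnegative, and the sign climbs back to order 0
    because all the lower derivatives vanish at K. *)
Lemma taylor4_ge (R : realType) (F F1 F2 F3 F4 : R -> R) (K D : R) :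
  (forall x : R, 0 < x -> is_derive x 1 F (F1 x)) ->
  (forall x : R, 0 < x -> is_derive x 1 F1 (F2 x)) ->
  (forall x : R, 0 < x -> is_derive x 1 F2 (F3 x)) ->
  (forall x : R, 0 < x -> is_derive x 1 F3 (F4 x)) ->
  0 < K -> 0 <= D -> (forall x, 0 < x -> - D <= x ^+ 2 * F4 x) ->
  forall y, 0 < y ->
  F K + F1 K * (y - K) + F2 K / 2 * (y - K) ^+ 2 + F3 K / 6 * (y - K) ^+ 3
    - D * ((y - K) ^+ 4 / (12 * K ^+ 2)) <= F y.
Proof.
move=> d1 d2 d3 d4 K0 D0 DF y y0.
pose rho (x : R) := (x - K) ^+ 3 / (6 * K) - x ^+ 2 / 2 * (ln x - ln K)
  + 3 / 4 * x ^+ 2 - K * x + K ^+ 2 / 4.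
pose rho1 (x : R) := (x - K) ^+ 2 / (2 * K) - x * (ln x - ln K) + x - K.
pose rho2 (x : R) := (x - K) / K - (ln x - ln K).
pose rho3 (x : R) := K^-1 - x^-1.
have dr (x : R) : 0 < x -> is_derive x 1 rho (rho1 x).
  move=> x0; have dl := is_derive1_ln x0.
  by apply: is_derive_eq; rewrite /rho1 /GRing.scale/=; field; rewrite !gt_eqF.
have dr1 (x : R) : 0 < x -> is_derive x 1 rho1 (rho2 x).
  move=> x0; have dl := is_derive1_ln x0.
  by apply: is_derive_eq; rewrite /rho2 /GRing.scale/=; field; rewrite !gt_eqF.
have dr2 (x : R) : 0 < x -> is_derive x 1 rho2 (rho3 x).
  move=> x0; have dl := is_derive1_ln x0.
  by apply: is_derive_eq; rewrite /rho3 /GRing.scale/=; field; rewrite !gt_eqF.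
have dr3 (x : R) : 0 < x -> is_derive x 1 rho3 (x^-1 ^+ 2).
  move=> x0.
  have di := is_derive_invr x0.
  by apply: is_derive_eq; ring.
pose g (x : R) := F x - (F K + F1 K * (x - K) + F2 K / 2 * (x - K) ^+ 2
  + F3 K / 6 * (x - K) ^+ 3) + D * rho x.
pose g1 (x : R) := F1 x - (F1 K + F2 K * (x - K) + F3 K / 2 * (x - K) ^+ 2) + D * rho1 x.
pose g2 (x : R) := F2 x - (F2 K + F3 K * (x - K)) + D * rho2 x.
pose g3 (x : R) := F3 x - F3 K + D * rho3 x.
pose g4 (x : R) := F4 x + D * x^-1 ^+ 2.
have g0 : 0 <= g y.
  apply: (@ge0_of_derive_sign _ g g1 K _ K0 _ _ y y0).
  - move=> x x0; have d1x := d1 x x0; have drx := dr x x0.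
    by apply: is_derive_eq; rewrite /g1 /GRing.scale/=; field.
  - by rewrite /g /rho; field; rewrite gt_eqF.
  apply: (@sign_of_derive_ge0 _ g1 g2 K _ K0).
  - move=> x x0; have d2x := d2 x x0; have drx := dr1 x x0.
    by apply: is_derive_eq; rewrite /g2 /GRing.scale/=; field.
  - by rewrite /g1 /rho1; field; rewrite gt_eqF.
  apply: (@ge0_of_derive_sign _ g2 g3 K _ K0).
  - move=> x x0; have d3x := d3 x x0; have drx := dr2 x x0.
    by apply: is_derive_eq; rewrite /g3 /GRing.scale/=; field.
  - by rewrite /g2 /rho2; field; rewrite gt_eqF.
  apply: (@sign_of_derive_ge0 _ g3 g4 K _ K0).
  - move=> x x0; have d4x := d4 x x0; have drx := dr3 x x0.
    by apply: is_derive_eq; rewrite /g4 /GRing.scale/=; ring.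
  - by rewrite /g3 /rho3; ring.
  move=> x x0; rewrite /g4.
  have -> : F4 x + D * x^-1 ^+ 2 = (x ^+ 2 * F4 x + D) / x ^+ 2.
    by field; rewrite gt_eqF.
  by rewrite divr_ge0 ?sqr_ge0// -lerBlDr sub0r DF.
have := ler_wpM2l D0 (log_kernel_le K0 y0).
rewrite -/(rho y); move: g0; rewrite /g; lra.
Qed.

(** * The gamma distribution function *)

Lemma gamma_pdfE (R : realType) (m : R) :
  gamma_pdf (m + 1) = (gamma_cdf_d1 m \_ `]0, +oo[) :> (R -> R).
Proof.
apply/funext => x; rewrite /gamma_pdf patchE addrK; case: ifPn => x0.
  by rewrite mem_set//= in_itv/= x0.
by rewrite memNset//= in_itv/= andbT; exact/negP.
Qed.

Lemma gamma_cdfE (R : realType) (m x : R) :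
  gamma_cdf (m + 1) x = \int[@lebesgue_measure R]_(y in `]0, x]) gamma_cdf_d1 m y.
Proof.
rewrite /gamma_cdf gamma_pdfE -Rintegral_mkcondr; congr Rintegral.
apply/seteqP; split => y /=; rewrite !in_itv/= ?andbT; first by case=> -> ->.
by move=> /andP[-> ->].
Qed.

Lemma integrable_gamma_cdf_d1 (R : realType) (m : R) : 0 <= m ->
  (@lebesgue_measure R).-integrable `]0, +oo[ (EFin \o gamma_cdf_d1 m).
Proof.
move=> m0.
have := @integrableZr _ _ R (@lebesgue_measure R) _ (measurable_itv _)
  (Gamma_fun (m + 1))^-1 _ (integrable_gamma_ker m0).
by apply: eq_integrable => //; move=> x _; rewrite /= EFinM.
Qed.

Lemma integrable_gamma_cdf_d1_itv (R : realType) (m x : R) : 0 <= m ->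
  (@lebesgue_measure R).-integrable `]0, x] (EFin \o gamma_cdf_d1 m).
Proof.
by move=> /integrable_gamma_cdf_d1; apply: integrableS => //; exact: subset_itvl.
Qed.

Lemma gamma_cdf_ge0 (R : realType) (m x : R) : 0 <= m -> 0 <= gamma_cdf (m + 1) x.
Proof.
by move=> m0; rewrite gamma_cdfE; apply: Rintegral_ge0 => y _; exact: gamma_cdf_d1_ge0.
Qed.

Lemma Rintegral_gamma_cdf_d1 (R : realType) (m : R) : 0 <= m ->
  \int[@lebesgue_measure R]_(y in `]0, +oo[) gamma_cdf_d1 m y = 1.
Proof.
move=> m0; rewrite RintegralZr ?integrable_gamma_ker// -Gamma_funE divff// gt_eqF//.
by apply: Gamma_fun_gt0; lra.
Qed.

Lemma gamma_cdf_le1 (R : realType) (m x : R) : 0 <= m -> gamma_cdf (m + 1) x <= 1.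
Proof.
move=> m0; rewrite gamma_cdfE -(Rintegral_gamma_cdf_d1 m0).
apply: le_Rintegral_subset => //.
- exact: subset_itvl.
- exact: integrable_gamma_cdf_d1.
- exact: integrable_gamma_cdf_d1_itv.
- by move=> y _; exact: gamma_cdf_d1_ge0.
Qed.

Lemma gamma_cdf_nondecreasing (R : realType) (m : R) : 0 <= m ->
  {homo (@gamma_cdf R (m + 1)) : x y / x <= y}.
Proof.
move=> m0 x y xy; rewrite !gamma_cdfE; apply: le_Rintegral_subset => //.
- by apply: subset_itvl; rewrite bnd_simp.
- exact: integrable_gamma_cdf_d1_itv.
- exact: integrable_gamma_cdf_d1_itv.
- by move=> z _; exact: gamma_cdf_d1_ge0.
Qed.

Lemma gamma_cdf0 (R : realType) (m : R) : gamma_cdf (m + 1) 0 = 0 :> R.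
Proof. by rewrite gamma_cdfE set_itv_ge ?bnd_simp ?ltxx// Rintegral_set0. Qed.

Lemma gamma_cdf_le_id (R : realType) (m x : R) : 0 <= m -> 0 <= x ->
  gamma_cdf (m + 1) x <= x.
Proof.
move=> m0 x0; rewrite gamma_cdfE.
have H : \int[@lebesgue_measure R]_(y in `]0, x]) cst 1 y = x.
  rewrite Rintegral_cst//= lebesgue_measure_itv/= lte_fin mul1r.
  by move: x0; rewrite le_eqVlt => /predU1P[<-|->]; rewrite ?ltxx//= subr0.
rewrite -[leRHS]H; apply: le_Rintegral => //.
- exact: integrable_gamma_cdf_d1_itv.
- have : (@lebesgue_measure R).-integrable `[0, x] (EFin \o cst 1).
    apply: continuous_compact_integrable; first exact: segment_compact.
    by apply: continuous_subspaceT => y; exact: cvg_cst.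
  by apply: integrableS => //; exact: subset_itv_oc_cc.
- by move=> y /=; rewrite in_itv/= => /andP[y0 _]; exact: gamma_cdf_d1_le1.
Qed.

Lemma is_derive_gamma_cdf (R : realType) (m x : R) : 0 <= m -> 0 < x ->
  is_derive x 1 (gamma_cdf (m + 1)) (gamma_cdf_d1 m x).
Proof.
move=> m0 x0.
have -> : gamma_cdf (m + 1) = (fun z => \int[@lebesgue_measure R]_(y in `]0, z]) gamma_cdf_d1 m y).
  by apply/funext => z; exact: gamma_cdfE.
have xx1 : x < x + 1 by rewrite ltrDl.
have cx : {for x, continuous (gamma_cdf_d1 m)}.
  by apply: is_derive_continuous; exact: is_derive_gamma_cdf_d1.
have [] := @continuous_FTC1 R (gamma_cdf_d1 m) (BRight 0) x (x + 1) xx1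
  (integrable_gamma_cdf_d1_itv _ m0) _ cx; first exact: x0.
by move=> d1 d2; apply: DeriveDef => //; rewrite -derive1E.
Qed.

(** * Taylor inequalities for the gamma distribution function *)

(** Passage to the limit at 0 for a quadratic polynomial. *)
Lemma ge0_constant_coef (R : realType) (a b c : R) :
  (forall y, 0 < y -> 0 <= a + b * y + c * y ^+ 2) -> 0 <= a.
Proof.
move=> h; rewrite leNgt; apply/negP => a0.
have d0 : 0 < `|b| + `|c| - a by rewrite subr_gt0 (lt_le_trans a0)// addr_ge0.
(* small enough for the linear and quadratic terms to stay below - a *)
pose y := - a / (`|b| + `|c| - a).
have y0 : 0 < y by rewrite divr_gt0// oppr_gt0.
have y1 : y <= 1 by rewrite ler_pdivrMr// mul1r lerDr addr_ge0.
have yE : y * (`|b| + `|c| - a) = - a by rewrite /y divfK// gt_eqF.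
have := h y y0.
have hb : b * y <= `|b| * y by rewrite ler_wpM2r ?ler_norm// ltW.
have hc : c * y ^+ 2 <= `|c| * y.
  apply: (@le_trans _ _ (`|c| * y ^+ 2)); first by rewrite ler_wpM2r ?ler_norm// sqr_ge0.
  by rewrite ler_wpM2l// expr2 ler_piMr// ltW.
have hay : 0 < (- a) * y by rewrite mulr_gt0// oppr_gt0.
lra.
Qed.

(** The origin is included, as an endpoint of the first interpolation cell.  F need
    not be twice differentiable there, so the case y = 0 is a limit that uses
    F 0 = 0 and 0 <= F y <= y for y > 0. *)
Lemma gamma_cdf_taylor2 (R : realType) (m K y : R) : 1 <= m -> 0 < K -> 0 <= y ->
  gamma_cdf (m + 1) K + gamma_cdf_d1 m K * (y - K) - 8^-1 * (y - K) ^+ 2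
    <= gamma_cdf (m + 1) y <=
  gamma_cdf (m + 1) K + gamma_cdf_d1 m K * (y - K) + 2^-1 * (y - K) ^+ 2.
Proof.
move=> m1 K0; have m0 : 0 <= m by lra.
set F := @gamma_cdf R (m + 1).
have lo x : 0 < x -> F K + gamma_cdf_d1 m K * (x - K) - 8^-1 * (x - K) ^+ 2 <= F x.
  move=> x0; have := @taylor2_ge R F (gamma_cdf_d1 m) (gamma_cdf_d2 m) K (- 4^-1)
    (fun x => is_derive_gamma_cdf m0) (fun x => @is_derive_gamma_cdf_d1 R m x) K0
    (fun x => gamma_cdf_d2_ge m1) x x0.
  rewrite (_ : - 4^-1 / 2 = - 8^-1); last by field.
  by rewrite mulNr.
have up x : 0 < x -> F x <= F K + gamma_cdf_d1 m K * (x - K) + 2^-1 * (x - K) ^+ 2.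
  move=> x0; rewrite -lerN2.
  have := @taylor2_ge R (fun x => - F x) (fun x => - gamma_cdf_d1 m x)
    (fun x => - gamma_cdf_d2 m x) K (- 1) _ _ K0 _ x x0.
  set T := (X in (_ -> _ -> _ -> X <= _) -> _).
  have -> : T = - (F K + gamma_cdf_d1 m K * (x - K) + 2^-1 * (x - K) ^+ 2) by rewrite /T; field.
  apply.
  - by move=> z z0; apply: is_deriveN; exact: is_derive_gamma_cdf.
  - by move=> z z0; apply: is_deriveN; exact: is_derive_gamma_cdf_d1.
  - by move=> z z0; rewrite lerN2 gamma_cdf_d2_le1.
rewrite le_eqVlt => /predU1P[<-|y0]; last by rewrite lo// up.
have -> : F 0 = 0 by exact: gamma_cdf0.
rewrite sub0r sqrrN; apply/andP; split.
- rewrite -subr_ge0.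
  apply: (@ge0_constant_coef _ _ (1 - gamma_cdf_d1 m K - 4^-1 * K) (8^-1)) => x x0.
  have := le_trans (lo x x0) (gamma_cdf_le_id m0 (ltW x0)).
  by rewrite -subr_ge0; congr (0 <= _); field.
- apply: (@ge0_constant_coef _ _ (gamma_cdf_d1 m K - K) (2^-1)) => x x0.
  have := le_trans (gamma_cdf_ge0 x m0) (up x x0).
  by congr (0 <= _); field.
Qed.

Lemma gamma_cdf_taylor4 (R : realType) (m K y : R) : 1 <= m -> 0 < K -> 0 < y ->
  `|gamma_cdf (m + 1) y - (gamma_cdf (m + 1) K + gamma_cdf_d1 m K * (y - K)
     + gamma_cdf_d2 m K / 2 * (y - K) ^+ 2 + gamma_cdf_d3 m K / 6 * (y - K) ^+ 3)|
  <= (y - K) ^+ 4 / (4 * K ^+ 2).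
Proof.
move=> m1 K0 y0; have m0 : 0 <= m by lra.
set F := @gamma_cdf R (m + 1).
have b4 x : 0 < x -> - 3 <= x ^+ 2 * gamma_cdf_d4 m x <= 3.
  by move=> x0; rewrite -ler_norml; exact: gamma_cdf_d4_bound.
have c4 : 3 * ((y - K) ^+ 4 / (12 * K ^+ 2)) = (y - K) ^+ 4 / (4 * K ^+ 2).
  by field; rewrite gt_eqF.
rewrite ler_norml -c4; apply/andP; split.
  have h x : 0 < x -> - 3 <= x ^+ 2 * gamma_cdf_d4 m x by move=> /b4/andP[].
  have := @taylor4_ge R F (gamma_cdf_d1 m) (gamma_cdf_d2 m) (gamma_cdf_d3 m) (gamma_cdf_d4 m) K 3
    (fun x => is_derive_gamma_cdf m0) (fun x => @is_derive_gamma_cdf_d1 R m x)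
    (fun x => @is_derive_gamma_cdf_d2 R m x) (fun x => @is_derive_gamma_cdf_d3 R m x) K0
    (ler0n _ _) h y y0.
  lra.
have h x : 0 < x -> - 3 <= x ^+ 2 * (- gamma_cdf_d4 m x).
  by move=> /b4/andP[_ ?]; rewrite mulrN lerN2.
have := @taylor4_ge R (fun x => - F x) (fun x => - gamma_cdf_d1 m x) (fun x => - gamma_cdf_d2 m x)
  (fun x => - gamma_cdf_d3 m x) (fun x => - gamma_cdf_d4 m x) K 3
  (fun x x0 => is_deriveN (is_derive_gamma_cdf m0 x0))
  (fun x x0 => is_deriveN (is_derive_gamma_cdf_d1 m x0))
  (fun x x0 => is_deriveN (is_derive_gamma_cdf_d2 m x0))
  (fun x x0 => is_deriveN (is_derive_gamma_cdf_d3 m x0)) K0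
  (ler0n _ _) h y y0.
lra.
Qed.

(** * Expectations of functions of a random variable with a density *)

Section density.
Local Open Scope ereal_scope.
Context d (T : measurableType d) (R : realType) (P : probability T R).
Variables (X : {RV P >-> R}) (g : R -> R).
Hypothesis mg : measurable_fun [set: measurableTypeR R] g.
Hypothesis g0 : forall x, (0 <= g x)%R.
Hypothesis Xg : forall A : set R, measurable A ->
  distribution P X A = \int[@lebesgue_measure R]_(x in A) (g x)%:E.
Local Notation mu := (@lebesgue_measure R).

Let expectation_indic_density (E : set (measurableTypeR R)) : measurable E ->
  \int[P]_w (\1_E (X w))%:E = \int[mu]_x ((\1_E x)%:E * (g x)%:E).
Proof.
move=> mE.
transitivity (\int[P]_w (\1_(X @^-1` E) w)%:E) => //.
rewrite integral_indic//; last by rewrite -[X in measurable X]setTI; exact: measurable_funPT.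
rewrite setIT -[LHS]/(distribution P X E) Xg//.
rewrite [LHS]integral_mkcond; apply: eq_integral => x _.
by rewrite patchE indicE; case: (x \in E); rewrite ?mul1e ?mul0e.
Qed.

Import HBNNSimple.

Let expectation_nnsfun_density (f : {nnsfun (measurableTypeR R) >-> R}) :
  \int[P]_w (f (X w))%:E = \int[mu]_x ((f x)%:E * (g x)%:E).
Proof.
have mE r : measurable (f @^-1` [set r]) by [].
have mI r : measurable_fun [set: measurableTypeR R] (\1_(f @^-1` [set r]) : _ -> R).
  exact: measurable_indic.
under [LHS]eq_integral do rewrite fimfunE -fsumEFin//.
rewrite [LHS]ge0_integral_fsum//; last 2 first.
  - move=> r; apply/measurable_EFinP; apply: measurable_funM => //.
    by apply: measurableT_comp => //; exact: (mI r).
  - by move=> n x _; rewrite EFinM nnfun_muleindic_ge0.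
under [RHS]eq_integral.
  move=> x xD; rewrite fimfunE -fsumEFin// ge0_mule_fsuml; last first.
    by move=> r; rewrite EFinM nnfun_muleindic_ge0.
  over.
rewrite [RHS]ge0_integral_fsum//; last 2 first.
  - move=> r; apply: emeasurable_funM; last exact/measurable_EFinP.
    by apply/measurable_EFinP; apply: measurable_funM => //; exact: (mI r).
  - move=> n x _; rewrite EFinM mule_ge0//; first by rewrite nnfun_muleindic_ge0.
    by rewrite lee_fin.
apply: eq_fsbigr => r _.
have [r0|r0] := leP 0%R r; last first.
  rewrite (_ : f @^-1` [set r] = set0); last first.
    by apply/seteqP; split => // x /= fxr; have : (0 <= f x)%R by []; rewrite fxr leNgt r0.
  rewrite !integral0_eq//.
    by move=> x _; rewrite indic0 mulr0 mul0e.
  by move=> x _; rewrite indic0 mulr0.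
transitivity (r%:E * \int[P]_w (\1_(f @^-1` [set r]) (X w))%:E).
  rewrite -ge0_integralZl//.
  - by apply/measurable_EFinP; apply: measurableT_comp => //; exact: (mI r).
rewrite expectation_indic_density// -ge0_integralZl//.
- by under eq_integral do rewrite muleA -EFinM.
- apply: emeasurable_funM; last exact/measurable_EFinP.
  by apply/measurable_EFinP; exact: (mI r).
- by move=> x _; rewrite mule_ge0 ?lee_fin.
Qed.

(** Indicators, then simple functions, then monotone limits of these. *)
Lemma ge0_expectation_density (f : R -> \bar R) :
  measurable_fun [set: measurableTypeR R] f -> (forall x, 0 <= f x) ->
  \int[P]_w f (X w) = \int[mu]_x (f x * (g x)%:E).
Proof.
move=> mf f0.
pose f_ := nnsfun_approx (@measurableT _ (measurableTypeR R)) mf.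
have mfn i : measurable_fun [set: measurableTypeR R] (f_ i : _ -> R) by [].
have ndf i j : (i <= j)%N -> forall x, (f_ i x <= f_ j x)%R.
  by move=> ij; apply/lefP/nd_nnsfun_approx.
transitivity (lim (\int[P]_w (f_ n (X w))%:E @[n --> \oo])).
  rewrite -monotone_convergence//=.
  - apply: eq_integral => x _; apply/esym/cvg_lim => //=.
    exact: cvg_nnsfun_approx.
  - by move=> i; apply/measurable_EFinP; apply: measurableT_comp => //; exact: (mfn i).
  - by move=> i ? _; rewrite lee_fin.
  - by move=> ? _ ? ? mn; rewrite lee_fin; exact: ndf.
transitivity (lim (\int[mu]_x ((f_ n x)%:E * (g x)%:E) @[n --> \oo])).
  by apply: congr_lim; apply/funext => n /=; exact: expectation_nnsfun_density.
rewrite -monotone_convergence//=.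
- apply: eq_integral => x _; apply/cvg_lim => //=.
  by apply: cvgeZr => //; exact: cvg_nnsfun_approx.
- move=> i; apply: emeasurable_funM; last exact/measurable_EFinP.
  by apply/measurable_EFinP; exact: (mfn i).
- by move=> i ? _; rewrite mule_ge0// lee_fin.
- by move=> ? _ ? ? mn; rewrite lee_wpmul2r ?lee_fin//; exact: ndf.
Qed.
End density.

(** * Expectations of functions of a gamma variable *)

Definition has_gamma_law (R : realType) d (T : measurableType d)
    (P : probability T R) (X : {RV P >-> R}) (u : R) : Prop :=
  forall A : set R, measurable A -> distribution P X A =
    (\int[@lebesgue_measure R]_(x in A) (gamma_pdf u x)%:E)%E.

Lemma gamma_expectation_le (R : realType) d (T : measurableType d)
    (P : probability T R) (X : {RV P >-> R}) (m : R) (phi : R -> R)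
    (n : nat) (c : nat -> R) : 0 <= m ->
  has_gamma_law X (m + 1) ->
  measurable_fun [set: measurableTypeR R] phi ->
  (forall y, 0 <= phi y) ->
  (forall y, 0 < y -> phi y <= \sum_(i < n) c i * y ^+ i) ->
  fine ('E_P[phi \o X])%E <= \sum_(i < n) c i * \prod_(j < i) (m + 1 + j%:R).
Proof.
move=> m0 law mphi phi0 phi_le.
have pdf0 x : 0 <= gamma_pdf (m + 1) x.
  by rewrite gamma_pdfE patchE; case: ifP => // _; exact: gamma_cdf_d1_ge0.
have mpdf : measurable_fun [set: measurableTypeR R] (gamma_pdf (m + 1)).
  apply/measurable_EFinP; rewrite gamma_pdfE -restrict_EFin.
  have /integrable_mkcond := integrable_gamma_cdf_d1 m0.
  by move=> /(_ (measurable_itv _)) /measurable_int.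
rewrite unlock/=.
rewrite (@ge0_expectation_density _ _ _ P X _ mpdf pdf0 law (EFin \o phi)); first last.
- by move=> x; rewrite lee_fin.
- exact/measurable_EFinP.
have G0 : Gamma_fun (m + 1) != 0 by rewrite gt_eqF// Gamma_fun_gt0//; lra.
have <- : \int[@lebesgue_measure R]_(x in `]0, +oo[)
   ((\sum_(i < n) c i * x ^+ i) * gamma_cdf_d1 m x) = \sum_(i < n) c i * \prod_(j < i) (m + 1 + j%:R).
  transitivity (\int[@lebesgue_measure R]_(x in `]0, +oo[)
   ((\sum_(i < n) c i * x ^+ i) * gamma_ker m x / Gamma_fun (m + 1))).
    by apply: eq_Rintegral => x _; rewrite mulrA.
  rewrite RintegralZr//; last exact: integrable_poly_gamma_ker.
  by rewrite Rintegral_poly_gamma_ker// -Gamma_funE mulfK.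
have ip : (@lebesgue_measure R).-integrable `]0, +oo[
    (EFin \o (fun x => (\sum_(i < n) c i * x ^+ i) * gamma_cdf_d1 m x)).
  have := @integrableZr _ _ R (@lebesgue_measure R) _ (measurable_itv _)
    (Gamma_fun (m + 1))^-1 _ (integrable_poly_gamma_ker n c m0).
  by apply: eq_integrable => // x _; rewrite /= -EFinM /gamma_cdf_d1 mulrA.
rewrite /Rintegral.
have le : (\int[@lebesgue_measure R]_x ((phi x)%:E * (gamma_pdf (m + 1) x)%:E) <=
   \int[@lebesgue_measure R]_(x in `]0%R, +oo[) ((\sum_(i < n) c i * x ^+ i) * gamma_cdf_d1 m x)%:E)%E.
  rewrite [leRHS]integral_mkcond; apply: ge0_le_integral => //.
  - by move=> x _; rewrite mule_ge0 ?lee_fin.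
  - by apply: emeasurable_funM; exact/measurable_EFinP.
  - have /integrable_mkcond := ip.
    by move=> /(_ (measurable_itv _)) /measurable_int.
  - move=> x _; rewrite gamma_pdfE !patchE; case: ifPn; last by rewrite mule0.
    rewrite inE/= in_itv/= andbT => x0.
    by rewrite -EFinM lee_fin ler_wpM2r ?gamma_cdf_d1_ge0// phi_le.
have mD : measurable (`]0, +oo[%classic : set (measurableTypeR R)) by exact: measurable_itv.
have fin2 := integrable_fin_num mD ip.
have ge0 : (0 <= \int[@lebesgue_measure R]_x ((phi x)%:E * (gamma_pdf (m + 1) x)%:E))%E.
  by apply: integral_ge0 => x _; rewrite mule_ge0 ?lee_fin.
apply: fine_le => //.
by rewrite ge0_fin_numE// (le_lt_trans le)// ltey_eq fin2.
Qed.

(** The central moments of the gamma law of shape u of orders 1 to 4 are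
    0, u, 2 u and 3 u^2 + 6 u. *)
Lemma gamma_centered_expectation_le (R : realType) d (T : measurableType d)
    (P : probability T R) (X : {RV P >-> R}) (u : R) (phi : R -> R)
    (b0 b1 b2 b3 b4 : R) : 1 <= u ->
  has_gamma_law X u ->
  measurable_fun [set: measurableTypeR R] phi ->
  (forall y, 0 <= phi y) ->
  (forall y, 0 < y -> phi y <= b0 + b1 * (y - u) + b2 * (y - u) ^+ 2
     + b3 * (y - u) ^+ 3 + b4 * (y - u) ^+ 4) ->
  fine ('E_P[phi \o X])%E <= b0 + b2 * u + b3 * (2 * u) + b4 * (3 * u ^+ 2 + 6 * u).
Proof.
move=> u1 law mphi phi0 phi_le.
(* the coefficients of the centered quartic in powers of y *)
pose c (i : nat) := nth 0 [:: b0 - b1 * u + b2 * u ^+ 2 - b3 * u ^+ 3 + b4 * u ^+ 4;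
  b1 - 2 * b2 * u + 3 * b3 * u ^+ 2 - 4 * b4 * u ^+ 3;
  b2 - 3 * b3 * u + 6 * b4 * u ^+ 2; b3 - 4 * b4 * u; b4] i.
have u0 : 0 <= u - 1 by lra.
rewrite -(subrK 1 u) in law.
have := @gamma_expectation_le R d T P X (u - 1) phi 5 c u0 law mphi phi0 _.
rewrite !big_ord_recr !big_ord0 /c/= => /(_ _)/le_trans; apply.
- move=> y y0; rewrite !big_ord_recr big_ord0 /c/=.
  by apply: le_trans (phi_le y y0) _; apply: eq_ler; ring.
- by apply: eq_ler; ring.
Qed.

Lemma expectation_complement (R : realType) d (T : measurableType d)
    (P : probability T R) (X : {RV P >-> R}) (phi : R -> R) :
  measurable_fun [set: measurableTypeR R] phi -> (forall y, 0 <= phi y <= 1) ->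
  fine ('E_P[(fun y => (1 - phi y)%R) \o X])%E = 1 - fine ('E_P[phi \o X])%E.
Proof.
move=> mphi phi01.
have iphi : P.-integrable setT (EFin \o (phi \o X)).
  apply: measurable_bounded_integrable => //.
  - by rewrite (le_lt_trans (probability_le1 _ _))// ltry.
  - apply: measurableT_comp => //; exact: mphi.
  - exists 1; split => // x x1 y _ /=; case/andP: (phi01 (X y)) => h0 h1.
    by rewrite ger0_norm// (le_trans h1)// ltW.
rewrite unlock.
have i1 : P.-integrable setT (EFin \o cst 1) by exact: finite_measure_integrable_cst.
have -> : (\int[P]_w ((((fun y => (1 - phi y)%R) \o X) w)%:E) =
   \int[P]_w (cst 1%R w)%:E - \int[P]_w ((phi \o X) w)%:E)%E.
  rewrite -integralB_EFin//.
rewrite fineB ?integrable_fin_num//; congr (_ - _).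
transitivity (fine (\int[P]_w (cst 1%:E w))%E) => //.
by rewrite integral_cst//= probability_setT mule1.
Qed.

Lemma gamma_centered_expectation_ge (R : realType) d (T : measurableType d)
    (P : probability T R) (X : {RV P >-> R}) (u : R) (phi : R -> R)
    (b0 b1 b2 b3 b4 : R) : 1 <= u ->
  has_gamma_law X u ->
  measurable_fun [set: measurableTypeR R] phi ->
  (forall y, 0 <= phi y <= 1) ->
  (forall y, 0 < y -> b0 + b1 * (y - u) + b2 * (y - u) ^+ 2
     + b3 * (y - u) ^+ 3 + b4 * (y - u) ^+ 4 <= phi y) ->
  b0 + b2 * u + b3 * (2 * u) + b4 * (3 * u ^+ 2 + 6 * u) <= fine ('E_P[phi \o X])%E.
Proof.
move=> u1 law mphi phi01 phi_ge.
have mphiC : measurable_fun [set: measurableTypeR R] (fun y => 1 - phi y).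
  by apply: measurable_funB => //; exact: mphi.
have phiC0 y : 0 <= 1 - phi y by rewrite subr_ge0; case/andP: (phi01 y).
have := @gamma_centered_expectation_le R d T P X u _ (1 - b0) (- b1) (- b2)
  (- b3) (- b4) u1 law mphiC phiC0.
rewrite (expectation_complement X mphi phi01) => H.
suff : 1 - fine ('E_P[phi \o X])%E <=
    1 - b0 + - b2 * u + - b3 * (2 * u) + - b4 * (3 * u ^+ 2 + 6 * u).
  by lra.
by apply: H => y y0; have := phi_ge y y0; lra.
Qed.

Lemma measurable_gamma_cdf_scaled (R : realType) (m s : R) : 0 <= m -> 0 < s ->
  measurable_fun [set: measurableTypeR R] (fun y => gamma_cdf (m + 1) (y / s)).
Proof.
move=> m0 s0; apply: nondecreasing_measurable => // x y xy.
by apply: gamma_cdf_nondecreasing => //; rewrite ler_pM2r ?invr_gt0.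
Qed.

Lemma expectation_gamma_cdf_order2 (R : realType) d (T : measurableType d)
    (P : probability T R) (X : {RV P >-> R}) (m u s : R) :
  1 <= m -> 1 <= u -> 0 < s ->
  has_gamma_law X u ->
  gamma_cdf (m + 1) (u / s) - 8^-1 * u / s ^+ 2
   <= fine ('E_P[fun w => (gamma_cdf (m + 1) (X w / s))%R])%E <=
  gamma_cdf (m + 1) (u / s) + 2^-1 * u / s ^+ 2.
Proof.
move=> m1 u1 s0 law; have m0 : 0 <= m by lra.
have K0 : 0 < u / s by rewrite divr_gt0//; lra.
have F01 y : 0 <= gamma_cdf (m + 1) (y / s) <= 1.
  by rewrite gamma_cdf_ge0// gamma_cdf_le1.
have mF := measurable_gamma_cdf_scaled m0 s0.
have sn : s != 0 by rewrite gt_eqF.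
apply/andP; split.
- have := @gamma_centered_expectation_ge R d T P X u _ (gamma_cdf (m + 1) (u / s))
    (gamma_cdf_d1 m (u / s) / s) (- (8^-1 / s ^+ 2)) 0 0 u1 law mF F01.
  move=> H; apply: le_trans (H _).
    by apply: eq_ler; ring.
  move=> y y0; have y0' : 0 <= y / s by rewrite ltW// divr_gt0.
  have /andP[+ _] := gamma_cdf_taylor2 m1 K0 y0'.
  apply: le_trans; apply: eq_ler; field; exact: sn.
- have := @gamma_centered_expectation_le R d T P X u _ (gamma_cdf (m + 1) (u / s))
    (gamma_cdf_d1 m (u / s) / s) (2^-1 / s ^+ 2) 0 0 u1 law mF (fun y => proj1 (andP (F01 y))).
  move=> H; apply: (le_trans (H _)); last first.
    by apply: eq_ler; ring.
  move=> y y0; have y0' : 0 <= y / s by rewrite ltW// divr_gt0.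
  have /andP[_ /le_trans] := gamma_cdf_taylor2 m1 K0 y0'.
  apply; apply: eq_ler; field; exact: sn.
Qed.

(** With K = u / s the remainder (y / s - K)^4 / (4 K^2) has expectation
    (3 u^2 + 6 u) / (4 u^2 s^2). *)
Lemma expectation_gamma_cdf_order4 (R : realType) d (T : measurableType d)
    (P : probability T R) (X : {RV P >-> R}) (m u s : R) :
  1 <= m -> 1 <= u -> 0 < s ->
  has_gamma_law X u ->
  `|fine ('E_P[fun w => (gamma_cdf (m + 1) (X w / s))%R])%E
    - (gamma_cdf (m + 1) (u / s) + gamma_cdf_d2 m (u / s) * u / (2 * s ^+ 2)
       + gamma_cdf_d3 m (u / s) * u / (3 * s ^+ 3))|
   <= (3 / 4 + 3 / (2 * u)) / s ^+ 2.
Proof.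
move=> m1 u1 s0 law; have m0 : 0 <= m by lra.
have u0 : 0 < u by lra.
have K0 : 0 < u / s by rewrite divr_gt0.
have F01 y : 0 <= gamma_cdf (m + 1) (y / s) <= 1.
  by rewrite gamma_cdf_ge0// gamma_cdf_le1.
have mF := measurable_gamma_cdf_scaled m0 s0.
have sn : s != 0 by rewrite gt_eqF.
have un : u != 0 by rewrite gt_eqF.
have T4 (y : R) : 0 < y -> `|gamma_cdf (m + 1) (y / s) - (gamma_cdf (m + 1) (u / s)
    + gamma_cdf_d1 m (u / s) / s * (y - u) + gamma_cdf_d2 m (u / s) / (2 * s ^+ 2) * (y - u) ^+ 2
    + gamma_cdf_d3 m (u / s) / (6 * s ^+ 3) * (y - u) ^+ 3)|
    <= (4 * u ^+ 2 * s ^+ 2)^-1 * (y - u) ^+ 4.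
  move=> y0; have y0' : 0 < y / s by rewrite divr_gt0.
  have := gamma_cdf_taylor4 m1 K0 y0'.
  set A := (X in `|_ - X|); set B := (X in _ <= X); set A' := (X in _ -> `|_ - X| <= _).
  have -> : A = A' by rewrite /A /A'; field; exact: sn.
  have -> // : B = (4 * u ^+ 2 * s ^+ 2)^-1 * (y - u) ^+ 4.
  by rewrite /B; field; rewrite un sn.
rewrite ler_distl; apply/andP; split.
- have := @gamma_centered_expectation_ge R d T P X u _ (gamma_cdf (m + 1) (u / s))
    (gamma_cdf_d1 m (u / s) / s) (gamma_cdf_d2 m (u / s) / (2 * s ^+ 2)) (gamma_cdf_d3 m (u / s) / (6 * s ^+ 3))
    (- (4 * u ^+ 2 * s ^+ 2)^-1) u1 law mF F01.
  move=> H; apply: le_trans (H _).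
    by apply: eq_ler; field; rewrite un sn.
  by move=> y /T4; rewrite ler_norml => /andP[+ _]; lra.
- have := @gamma_centered_expectation_le R d T P X u _ (gamma_cdf (m + 1) (u / s))
    (gamma_cdf_d1 m (u / s) / s) (gamma_cdf_d2 m (u / s) / (2 * s ^+ 2)) (gamma_cdf_d3 m (u / s) / (6 * s ^+ 3))
    ((4 * u ^+ 2 * s ^+ 2)^-1) u1 law mF (fun y => proj1 (andP (F01 y))).
  move=> H; apply: (le_trans (H _)); last first.
    by apply: eq_ler; field; rewrite un sn.
  by move=> y /T4; rewrite ler_norml => /andP[_ +]; lra.
Qed.

(** * The error at the nodes and between them *)

Lemma gammaL_cdf0 (R : realType) (d : measure_display) (T : measurableType d)
    (P : probability T R) (S : R -> {RV P >-> R}) (m s : R) :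
  gamma_process S -> 0 <= m -> 0 < s ->
  gammaL S s (gamma_cdf (m + 1)) 0 = 0.
Proof.
move=> [S0 _] m0 s0; rewrite /gammaL mulr0 unlock.
rewrite (@ae_eq_integral _ _ _ P setT (cst 0%E)).
- by rewrite integral_cst//= mul0e.
- by [].
- have mF := measurable_gamma_cdf_scaled m0 s0.
  apply/measurable_EFinP.
  have : measurable_fun [set: T] ((fun y => gamma_cdf (m + 1) (y / s)) \o S 0).
    by apply: measurableT_comp => //; exact: mF.
  by [].
- exact: measurable_cst.
- apply: filterS S0 => w /= -> _.
  by rewrite mul0r gamma_cdf0.
Qed.

(** For k <= 3 the second order bounds give 5 k / 8 <= 15 / 8.  For k >= 4 the
    fourth order ones give 9/8 + 15/(8 k) + 7/24 <= 1.8855. *)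
Lemma gammaL2_node_bound (R : realType) (d : measure_display) (T : measurableType d)
    (P : probability T R) (S : R -> {RV P >-> R}) (m t : R) (k : nat) :
  gamma_process S -> 1 <= m -> 0 < t ->
  `|gammaL2 S t (gamma_cdf (m + 1)) (k%:R / t) - gamma_cdf (m + 1) (k%:R / t)|
    <= 189 / 100 / t ^+ 2.
Proof.
move=> hS m1 t0; have m0 : 0 <= m by lra.
have t20 : 0 < 2 * t by rewrite mulr_gt0.
case: k => [|k].
  rewrite mul0r /gammaL2 !gammaL_cdf0// mulr0 gamma_cdf0 !subrr normr0.
  by rewrite divr_ge0// sqr_ge0.
have law := hS.2.
set n : R := k.+1%:R.
have n1 : 1 <= n by rewrite ler1n.
have n34 : n <= 3 \/ 4 <= n.
  have [h|h] := leqP k.+1 3; [left|right]; by rewrite /n ler_nat.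
move: n n1 n34 => n n1 n34.
have n0 : 0 < n by lra.
have n21 : 1 <= 2 * n by lra.
have eA : 2 * n / (2 * t) = n / t by field; rewrite gt_eqF.
have lA : 2 * t * (n / t) = 2 * n by field; rewrite gt_eqF.
have lB : t * (n / t) = n by field; rewrite gt_eqF.
have lawA : has_gamma_law (S (2 * n)) (2 * n) by apply: law; lra.
have lawB : has_gamma_law (S n) n by apply: law; lra.
rewrite /gammaL2 /gammaL lA lB.
set eA' := fine _; set eB' := fine _.
have i0 : 0 < (t ^+ 2)^-1 by rewrite invr_gt0 exprn_gt0.
have tn : t != 0 by rewrite gt_eqF.
have nn : n != 0 by rewrite gt_eqF.
case: n34 => [n3|n4'].
  have := expectation_gamma_cdf_order2 m1 n21 t20 lawA; rewrite eA -/eA' => hA.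
  have := expectation_gamma_cdf_order2 m1 n1 t0 lawB; rewrite -/eB' => hB.
  move: hA hB; set F := gamma_cdf (m + 1) (n / t).
  rewrite (_ : 8^-1 * (2 * n) / (2 * t) ^+ 2 = 16^-1 * (n * (t ^+ 2)^-1)); last by field.
  rewrite (_ : 2^-1 * (2 * n) / (2 * t) ^+ 2 = 4^-1 * (n * (t ^+ 2)^-1)); last by field.
  rewrite -!(mulrA _ n).
  have : n * (t ^+ 2)^-1 <= 3 * (t ^+ 2)^-1 by rewrite ler_wpM2r// ltW.
  set q := n * _ => q3 /andP[a1 a2] /andP[b1 b2].
  by rewrite ler_norml; apply/andP; split; lra.
have := expectation_gamma_cdf_order4 m1 n21 t20 lawA; rewrite eA -/eA' => hA.
have := expectation_gamma_cdf_order4 m1 n1 t0 lawB; rewrite -/eB' => hB.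
have K0 : 0 < n / t by rewrite divr_gt0.
have h3 := gamma_cdf_d3_bound m1 K0.
move: hA hB h3; set F := gamma_cdf (m + 1) (n / t).
set a2 := gamma_cdf_d2 m (n / t); set a3 := gamma_cdf_d3 m (n / t).
rewrite (_ : a2 * (2 * n) / (2 * (2 * t) ^+ 2) = a2 * n / t ^+ 2 / 4); last by field.
rewrite (_ : a3 * (2 * n) / (3 * (2 * t) ^+ 3) = (n / t * a3) / t ^+ 2 / 12); last by field.
rewrite (_ : a2 * n / (2 * t ^+ 2) = a2 * n / t ^+ 2 / 2); last by field.
rewrite (_ : a3 * n / (3 * t ^+ 3) = (n / t * a3) / t ^+ 2 / 3); last by field.
rewrite (_ : (3 / 4 + 3 / (2 * (2 * n))) / (2 * t) ^+ 2 =
  3 / 16 * (t ^+ 2)^-1 + 3 / 16 * (n^-1 * (t ^+ 2)^-1)); last by field; rewrite nn tn.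
rewrite (_ : (3 / 4 + 3 / (2 * n)) / t ^+ 2 =
  3 / 4 * (t ^+ 2)^-1 + 3 / 2 * (n^-1 * (t ^+ 2)^-1)); last by field; rewrite nn tn.
set y3 := n / t * a3; set i2 := (t ^+ 2)^-1 in i0 *.
have ni : n^-1 * i2 <= 4^-1 * i2.
  by rewrite ler_wpM2r ?(ltW i0)// lef_pV2 ?posrE.
set z2 := a2 * n * i2.
move=> hA hB; rewrite ler_norml => /andP[h3 h3'].
have h3i : - (7 / 4) * i2 <= y3 * i2 by rewrite ler_wpM2r// ltW.
have h3i' : y3 * i2 <= 7 / 4 * i2 by rewrite ler_wpM2r// ltW.
move: hA hB; rewrite !ler_norml => /andP[A1 A2] /andP[B1 B2].
by apply/andP; split; lra.
Qed.

(** Expanding both endpoint values at the interpolation point, the first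
    order terms cancel and the quadratic ones add up to
    theta (1 - theta) h^2 <= h^2 / 4. *)
Lemma gamma_cdf_interpolation (R : realType) (m a h theta : R) :
  1 <= m -> 0 <= a -> 0 < h -> 0 <= theta <= 1 -> 0 < a + theta * h ->
  `|theta * gamma_cdf (m + 1) (a + h) + (1 - theta) * gamma_cdf (m + 1) a
    - gamma_cdf (m + 1) (a + theta * h)| <= h ^+ 2 / 8.
Proof.
move=> m1 a0 h0 /andP[th0 th1] x0.
have ah0 : 0 <= a + h by lra.
have := gamma_cdf_taylor2 m1 x0 ah0.
have := gamma_cdf_taylor2 m1 x0 a0.
set x := a + theta * h; set Fx := gamma_cdf (m + 1) x; set fx := gamma_cdf_d1 m x.
have -> : a + h - x = (1 - theta) * h by rewrite /x; ring.
have -> : a - x = - (theta * h) by rewrite /x; ring.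
set Fa := gamma_cdf _ a; set Fb := gamma_cdf _ (a + h).
move=> /andP[a1 a2] /andP[b1 b2].
have th1' : 0 <= 1 - theta by lra.
have A1 := ler_wpM2l th1' a1; have A2 := ler_wpM2l th1' a2.
have B1 := ler_wpM2l th0 b1; have B2 := ler_wpM2l th0 b2.
have q : theta * (1 - theta) * h ^+ 2 <= 4^-1 * h ^+ 2.
  rewrite ler_wpM2r ?sqr_ge0// -subr_ge0.
  by rewrite (_ : _ - _ = (theta - 2^-1) ^+ 2) ?sqr_ge0//; field.
have q0 : 0 <= h ^+ 2 by rewrite sqr_ge0.
rewrite ler_norml; apply/andP; split; lra.
Qed.

(** From e^(-1/16) >= 15/16, and (16/15)^16 < 2.81. *)
Lemma expR1_le (R : realType) : expR 1 <= 281 / 100 :> R.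
Proof.
have h : expR (16^-1 : R) <= 16 / 15.
  rewrite -[16^-1]opprK expRN -[leRHS]invrK lef_pV2 ?posrE ?expR_gt0//.
  apply: le_trans (expR_ge1Dx _); lra.
have -> : expR 1 = expR (16^-1 : R) ^+ 16.
  by rewrite -expRM_natl; congr expR; field.
have e0 := expR_ge0 (16^-1 : R).
have : expR (16^-1 : R) ^+ 16 <= (16 / 15) ^+ 16 by rewrite lerXn2r ?nnegrE.
move/le_trans; apply; lra.
Qed.

Unset Implicit Arguments.

Theorem corollary4p1 (R : realType) (d : measure_display) (T : measurableType d)
    (P : probability T R) (S : R -> {RV P >-> R}) (hS : gamma_process S)
    (p : R) (hp : 2 <= p) (t : R) (ht : 0 < t) :
  (sup_norm (fun x : R => (gammaM2 S t (gamma_cdf p) x - gamma_cdf p x)%R) <=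
   ((17 / 12 + 27 / (16 * expR 1)) * (1 / t ^+ 2))%:E)%E.
Proof.
(* shapes are written m + 1 so that the mode of the density is m *)
have [m m1 ->] : exists2 m, 1 <= m & p = m + 1.
  by exists (p - 1); [lra|rewrite subrK].
have const : 189 / 100 + 8^-1 <= 17 / 12 + 27 / (16 * expR 1) :> R.
  have e0 := @expR_gt0 R 1; have e := @expR1_le R.
  suff : 27 / (16 * (281 / 100)) <= 27 / (16 * expR 1) :> R by lra.
  by rewrite ler_pM2l// lef_pV2 ?posrE ?ler_pM2l ?mulr_gt0.
have t2 : 0 <= (t ^+ 2)^-1 by rewrite invr_ge0 sqr_ge0.
apply: ub_ereal_sup => _ /= [x + <-]; rewrite in_itv/= andbT => x0.
rewrite lee_fin mul1r.
apply: le_trans (ler_wpM2r t2 const); rewrite mulrDl.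
have tx0 : 0 <= t * x by rewrite mulr_ge0// ltW.
rewrite /gammaM2.
have [n nE] : exists n : nat, Num.floor (t * x) = n%:Z.
  by exists `|Num.floor (t * x)|%N; rewrite gez0_abs// floor_ge0.
have tn := gt_eqF ht.
have /andP[f1 f2] := floor_itv (t * x).
rewrite nE in f1 f2 *.
rewrite intrD in f2.
rewrite -pmulrn /= in f1 f2 *.
set k : R := n%:R in f1 f2 *.
have k0 : 0 <= k by rewrite ler0n.
pose theta := t * x - k.
have th : 0 <= theta <= 1 by rewrite /theta; apply/andP; split; lra.
have -> : t * x - k = theta by [].
have -> : k + 1 - t * x = 1 - theta by rewrite /theta; ring.
have na := gammaL2_node_bound n hS m1 ht.
have nb := gammaL2_node_bound n.+1 hS m1 ht.
rewrite -[n.+1]addn1 natrD -/k in nb; rewrite -/k in na.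
have xE : x = k / t + theta * t^-1 by rewrite /theta; field; rewrite tn.
have bE : (k + 1) / t = k / t + t^-1 by rewrite mulrDl mul1r.
have interp : `|theta * gamma_cdf (m + 1) ((k + 1) / t) + (1 - theta) * gamma_cdf (m + 1) (k / t)
    - gamma_cdf (m + 1) x| <= 8^-1 / t ^+ 2.
  move: x0; rewrite le_eqVlt => /predU1P[x0|x0].
    have k00 : k = 0 by rewrite -x0 mulr0 in f1; apply/eqP; rewrite eq_le f1.
    have -> : theta = 0 by rewrite /theta -x0 k00 mulr0 subrr.
    by rewrite k00 -x0 !mul0r add0r subr0 mul1r subrr normr0 mulr_ge0.
  rewrite bE {1}xE; apply: le_trans (gamma_cdf_interpolation m1 _ _ th _) _.
  - by rewrite divr_ge0// ltW.
  - by rewrite invr_gt0.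
  - by rewrite -xE.
  - by rewrite exprVn mulrC.
move: na nb interp.
set A := gammaL2 _ _ _ (k / t); set B := gammaL2 _ _ _ _.
set FA := gamma_cdf _ (k / t); set FB := gamma_cdf _ ((k + 1) / t).
rewrite !ler_norml => /andP[na1 na2] /andP[nb1 nb2] /andP[i1 i2].
case/andP: th => th0 th1; have th1' : 0 <= 1 - theta by lra.
have A1 := ler_wpM2l th1' na1; have A2 := ler_wpM2l th1' na2.
have B1 := ler_wpM2l th0 nb1; have B2 := ler_wpM2l th0 nb2.
apply/andP; split; lra.
Qed.
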